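(* Let $[\,\cdot\,]$ be the Kauffman–Vogel polynomial specialized to $B=A^{-1}$ and $a=A$. Let $G$ be (a diagram of) a 4-valent rigid vertex embedded graph. If $G$ is ambient isotopic (as a rigid vertex graph) to a planar graph, then $$[G]=2^{c-1}(-A-A^{-1})^{v}A^{t(G)},$$ where $c$ is the number of connected components of $G$, $v$ is the number of vertices of $G$, and $t(G)$ is the twisting number of $G$.
   Context: A 4-valent rigid vertex embedded graph diagram is a nonempty diagram in the plane of a 4-valent graph embedded in three-space, with finitely many vertices and finitely many crossings (with over/under information). Loops, multiple edges, several components, and components that are closed curves without vertices are allowed; such closed curves count as connected components. A planar graph is one given by a diagram without crossings. Ambient isotopy of 4-valent rigid vertex embedded graphs: the equivalence relation on diagrams generated by planar isotopy and the moves: (I) removing or inserting a curl in a strand; (II) and (III) the second and third Reidemeister moves; (IV) moving a strand over, or under, a vertex; (V) rotating a rigid vertex by a half turn, i.e. a vertex is replaced by the vertex with a crossing of two cyclically adjacent half-edges on one side and the opposite (inverse half twist) crossing of the other two half-edges on the other side. Regular isotopy is generated by planar isotopy and moves (II)–(V). Smoothings: at a crossing of an unoriented diagram, orient the two strands locally so that the crossing is positive (standard sign convention). The A-smoothing is the smoothing compatible with these local orientations, and the B-smoothing is the other planar smoothing. Dubrovnik polynomial: $D$ is the regular isotopy invariant of unoriented link diagrams in variables $a,z$ determined by: $D_{L}-D_{L'}=z(D_{L_A}-D_{L_B})$, where $L'$ is obtained from $L$ by switching a crossing and $L_A,L_B$ by the A-smoothing and B-smoothing of that crossing of $L$; $D$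 is multiplied by $a$ (resp. $a^{-1}$) when a positive (resp. negative) curl is inserted in a strand; $D=1$ on the crossingless unknot. Kauffman–Vogel polynomial: for a 4-valent graph diagram $G$, choose at each vertex one of the two ways to replace it by a crossing. Let $\mathcal{L}$ be the family of link diagrams obtained by replacing each vertex either by the chosen crossing, or by its A-smoothing, or by its B-smoothing. Then $$[G]=\sum_{L\in\mathcal{L}}(-A)^{i(L)}(-B)^{j(L)}D_L\Big|_{z=A-B},$$ where $i(L)$ and $j(L)$ are the numbers of vertices replaced by A-smoothings and B-smoothings respectively. It is known (Kauffman–Vogel) that this does not depend on the choices and is a regular isotopy invariant. Twisting number: a knot-theoretic circuit of $G$ is a closed walk on $G$ that goes straight ahead (to the opposite edge) at each vertex, i.e. one corresponding to a link component when all vertices are replaced by crossings. The writhe of a knot-theoretic circuit $D$ is $w(D)=\sum_{x\in C(D)}\epsilon(x)$, where $C(D)$ is the set of crossings of the diagram (not vertices) at which $D$ crosses itself and $\epsilon(x)=\pm1$ is the sign of the crossing $x$ for a chosen orientation of $D$ (the result is independent of this choice). The twisting number $t(G)$ is the sum of the writhes of all knot-theoretic circuits of $G$. *)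

(* Defs.v *)
From HB Require Import structures.
From Stdlib Require Export Relation_Operators.
From mathcomp Require Export all_boot all_order all_algebra.
From mathcomp Require Export freeg.

Set Implicit Arguments.
Unset Strict Implicit.
Unset Printing Implicit Defensive.

Import GRing.Theory.

(******************************************************************************)
(* A plane diagram is put in general position with respect to the height      *)
(* function and recorded as the list, from bottom to top, of its elementary   *)
(* pieces.  The letter (k, i) is the tile k with exactly i strands running    *)
(* vertically on its left:                                                    *)
(*    Cup      a local minimum, creating the strands i and i+1;               *)
(*    Cap      a local maximum, joining the strands i and i+1;                *)
(*    Cross b  a crossing of the strands i and i+1; the strand going from     *)
(*             bottom left to top right is the over-strand iff b = true;      *)
(*    Vertex   a rigid 4-valent vertex with half-edges bottom left, bottom    *)
(*             right, top left and top right; bottom left is opposite to top  *)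
(*             right, and bottom right to top left.                           *)
(* Every diagram is planar isotopic to one in this form, and two such words   *)
(* describe planar isotopic diagrams iff they are related by planar_move      *)
(* below.                                                                     *)
(******************************************************************************)

Inductive tile : Type := Cup | Cap | Cross of bool | Vertex.
Definition word : Type := seq (tile * nat).

Definition bot (k : tile) : nat := if k is Cup then 0 else 2.
Definition top (k : tile) : nat := if k is Cap then 0 else 2.
Definition is_cross (k : tile) : bool := if k is Cross _ then true else false.
Definition is_vertex (k : tile) : bool := if k is Vertex then true else false.

(* Number of strands above w when there are n below; None if some tile does   *)
(* not fit.                                                                   *)
Fixpoint run (n : nat) (w : word) : option nat :=
  if w is (k, i) :: w' then
    if i + bot k <= n then run (n - bot k + top k) w' else None
  else Some n.

Definition graph_diagram (w : word) : bool := (0 < size w) && (run 0 w == Some 0).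

Definition num_vertices (w : word) : nat := count (fun l => is_vertex l.1) w.

Definition link_diagram (w : word) : bool :=
  graph_diagram w && ~~ has (fun l => is_vertex l.1) w.

Definition planar_diagram (w : word) : bool :=
  graph_diagram w && ~~ has (fun l => is_cross l.1) w.

(* Isotopies.  Moves that differ from the listed ones by a rotation of the    *)
(* plane are obtained from them by means of planar_move.                      *)

(* The same crossing or vertex read after a quarter turn. *)
Definition quarter_turn (k : tile) : tile :=
  if k is Cross b then Cross (~~ b) else k.

Inductive planar_move : word -> word -> Prop :=
| PM_exchange (p q : tile) (i j : nat) :
    planar_move [:: (q, i + bot p + j); (p, i)] [:: (p, i); (q, i + top p + j)]
| PM_zigzag_l (i : nat) : planar_move [:: (Cup, i); (Cap, i.+1)] [::]
| PM_zigzag_r (i : nat) : planar_move [:: (Cup, i.+1); (Cap, i)] [::]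
| PM_slide_cup (k : tile) (i : nat) : is_cross k || is_vertex k ->
    planar_move [:: (Cup, i); (k, i.+1)] [:: (Cup, i.+1); (quarter_turn k, i)]
| PM_slide_cap (k : tile) (i : nat) : is_cross k || is_vertex k ->
    planar_move [:: (k, i.+1); (Cap, i)] [:: (quarter_turn k, i); (Cap, i.+1)].

(* The curls on the i-th strand; left says on which side the loop lies.  In   *)
(* both cases the crossing is positive iff b = true.                          *)
Definition curl (left b : bool) (i : nat) : word :=
  if left then [:: (Cup, i); (Cross b, i.+1); (Cap, i)]
  else [:: (Cup, i.+1); (Cross b, i); (Cap, i.+1)].

Inductive move1 : word -> word -> Prop :=
| M1 (left b : bool) (i : nat) : move1 (curl left b i) [::].

Inductive move2 : word -> word -> Prop :=
| M2 (b : bool) (i : nat) : move2 [:: (Cross b, i); (Cross (~~ b), i)] [::].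

(* The side condition says that the three strands are layered: it excludes    *)
(* the two cyclic patterns of over-crossings.                                 *)
Inductive move3 : word -> word -> Prop :=
| M3 (b12 b13 b23 : bool) (i : nat) : (b13 == b12) || (b13 == b23) ->
    move3 [:: (Cross b12, i); (Cross b13, i.+1); (Cross b23, i)]
          [:: (Cross b23, i.+1); (Cross b13, i); (Cross b12, i.+1)].

Inductive move4 : word -> word -> Prop :=
| M4_from_right (b : bool) (i : nat) :
    move4 [:: (Vertex, i); (Cross b, i.+1); (Cross b, i)]
          [:: (Cross b, i.+1); (Cross b, i); (Vertex, i.+1)]
| M4_from_left (b : bool) (i : nat) :
    move4 [:: (Vertex, i.+1); (Cross b, i); (Cross b, i.+1)]
          [:: (Cross b, i); (Cross b, i.+1); (Vertex, i)].

Inductive move5 : word -> word -> Prop :=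
| M5 (b : bool) (i : nat) :
    move5 [:: (Cross b, i); (Vertex, i); (Cross (~~ b), i)] [:: (Vertex, i)].

Definition regular_move (x y : word) : Prop :=
  [\/ planar_move x y, move2 x y, move3 x y | move4 x y \/ move5 x y].

Definition ambient_move (x y : word) : Prop := regular_move x y \/ move1 x y.

Inductive apply_move (R : word -> word -> Prop) : word -> word -> Prop :=
| Apply_move (u x y v : word) :
    R x y -> graph_diagram (u ++ x ++ v) -> graph_diagram (u ++ y ++ v) ->
    apply_move R (u ++ x ++ v) (u ++ y ++ v).

Definition regular_isotopic : word -> word -> Prop :=
  clos_refl_sym_trans word (apply_move regular_move).

Definition ambient_isotopic : word -> word -> Prop :=
  clos_refl_sym_trans word (apply_move ambient_move).

(* Components and circuits.  The point (t, p) is the place where the p-th     *)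
(* strand crosses the horizontal line between the first t letters and the     *)
(* rest of the word; the pairs (t, p) that are not of this form are discarded *)
(* by is_point.                                                               *)

Definition point (w : word) : Type := ('I_(size w).+1 * 'I_(size w).*2.+1)%type.
HB.instance Definition _ (w : word) := Finite.on (point w).

Definition pt (w : word) (t p : nat) : point w := (inord t, inord p).

Definition is_point (w : word) (x : point w) : bool :=
  x.2 < odflt 0 (run 0 (take x.1 w)).

(* One letter carries x, on the line below it, straight ahead to y, on the    *)
(* line above it.                                                             *)
Definition rises (w : word) (x y : point w) : bool :=
  (y.1 == x.1.+1 :> nat) &&
  (if onth w x.1 is Some (k, i) then
     [|| (x.2 < i) && (y.2 == x.2 :> nat),
         (i + bot k <= x.2) && (y.2 == x.2 - bot k + top k :> nat)
       | (is_cross k || is_vertex k) &&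
         ((x.2 == i :> nat) && (y.2 == i.+1 :> nat)
          || (x.2 == i.+1 :> nat) && (y.2 == i :> nat))]
   else false).

(* y is the right neighbour of x, and both are the two ends of a Cap just     *)
(* above them or of a Cup just below them.                                    *)
Definition turns (w : word) (x y : point w) : bool :=
  [&& y.1 == x.1, y.2 == x.2.+1 :> nat &
      (if onth w x.1 is Some (Cap, i) then x.2 == i :> nat else false)
      || (0 < x.1) &&
         (if onth w x.1.-1 is Some (Cup, i) then x.2 == i :> nat else false)].

(* x and y are the bottom left and bottom right half-edges of a vertex. *)
Definition meets (w : word) (x y : point w) : bool :=
  [&& y.1 == x.1, y.2 == x.2.+1 :> nat &
      if onth w x.1 is Some (Vertex, i) then x.2 == i :> nat else false].

(* The classes of connect (circuit_adj w) are the knot-theoretic circuits,    *)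
(* those of connect (graph_adj w) are the connected components of the graph.  *)
Definition circuit_adj (w : word) : rel (point w) :=
  fun x y => [|| rises x y, rises y x, turns x y | turns y x].

Definition graph_adj (w : word) : rel (point w) :=
  fun x y => [|| circuit_adj x y, meets x y | meets y x].

Definition num_components (w : word) : nat :=
  n_comp (@graph_adj w) (@is_point w).

(* Circuits with an orientation: (x, true) is x traversed upwards, (x, false) *)
(* is x traversed downwards.                                                  *)
Definition oriented_adj (w : word) : rel (point w * bool) :=
  fun X Y => ((rises X.1 Y.1 || rises Y.1 X.1) && (Y.2 == X.2))
             || ((turns X.1 Y.1 || turns Y.1 X.1) && (Y.2 == ~~ X.2)).

(* The circuit through x, oriented upwards at x. *)
Definition oriented_circuit (w : word) (x : point w) : {set point w * bool} :=
  [set Y | connect (@oriented_adj w) (x, true) Y].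

(* Sign of Cross b when the strand starting at the bottom left (resp. bottom  *)
(* right) is oriented upwards iff d1 (resp. d2).                              *)
Definition crossing_sign (b d1 d2 : bool) : int :=
  if b == (d1 == d2) then 1%R else (-1)%R.

(* The inner sum is empty unless both strands of the t-th letter belong to C, *)
(* and then has a single term.                                                *)
Definition circuit_writhe (w : word) (C : {set point w * bool}) : int :=
  (\sum_(t < size w)
     if onth w t is Some (Cross b, i) then
       \sum_(d : bool * bool | ((pt w t i, d.1) \in C) && ((pt w t i.+1, d.2) \in C))
          crossing_sign b d.1 d.2
     else 0)%R.

(* One representative point, hence one orientation, for each circuit. *)
Definition twisting_number (w : word) : int :=
  (\sum_(x : point w | is_point x && (x \in roots (@circuit_adj w)))
     circuit_writhe (oriented_circuit x))%R.

(* Laurent polynomials in a and z with integer coefficients, as integral      *)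
(* combinations of the monomials a^m z^n, coded by (m, n).                    *)

Definition laurent : Type := {freeg (int * int) / int}.

Definition monomial (m n : int) : laurent := << (m, n) >>.

Definition mul_monomial (m n : int) (f : laurent) : laurent :=
  fglift (fun e : int * int => monomial (e.1 + m)%R (e.2 + n)%R) f.

Definition laurent_eval (F : fieldType) (a z : F) (f : laurent) : F :=
  (\sum_(e <- dom f) (coeff e f)%:~R * (a ^ e.1 * z ^ e.2))%R.

(* smoothing isA b i is the A-smoothing (isA = true) or the B-smoothing       *)
(* (isA = false) of (Cross b, i).  Cross true is positive when both strands   *)
(* go up, so its A-smoothing consists of two vertical strands; Cross false is *)
(* positive when one strand goes up and the other down.                       *)
Definition smoothing (isA b : bool) (i : nat) : word :=
  if isA == b then [::] else [:: (Cap, i); (Cup, i)].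

Record dubrovnik (D : word -> laurent) : Prop := Dubrovnik {
  dubrovnik_isotopy : forall L L' : word,
    link_diagram L -> link_diagram L' -> regular_isotopic L L' -> D L = D L';
  dubrovnik_skein : forall (u v : word) (b : bool) (i : nat),
    link_diagram (u ++ (Cross b, i) :: v) ->
    (D (u ++ (Cross b, i) :: v) - D (u ++ (Cross (~~ b), i) :: v)
     = mul_monomial 0 1 (D (u ++ smoothing true b i ++ v)
                         - D (u ++ smoothing false b i ++ v)))%R;
  dubrovnik_curl : forall (u v : word) (left b : bool) (i : nat),
    link_diagram (u ++ v) -> link_diagram (u ++ curl left b i ++ v) ->
    (D (u ++ curl left b i ++ v)
     = mul_monomial (if b then 1 else -1) 0 (D (u ++ v)))%R;
  dubrovnik_unknot : D [:: (Cup, 0); (Cap, 0)] = monomial 0 0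
}.

(* What a vertex is replaced by: the crossing (None), its A-smoothing         *)
(* (Some true) or its B-smoothing (Some false).                               *)
Definition resolve_vertex (b : bool) (r : option bool) (i : nat) : word :=
  if r is Some isA then smoothing isA b i else [:: (Cross b, i)].

(* The successive vertices of w, from bottom to top, use the successive items *)
(* of ch (the crossing chosen there) and of s.                                *)
Fixpoint resolve (ch : seq bool) (s : seq (option bool)) (w : word) : word :=
  match w with
  | [::] => [::]
  | (Vertex, i) :: w' =>
      resolve_vertex (head true ch) (head None s) i
        ++ resolve (behead ch) (behead s) w'
  | l :: w' => l :: resolve ch s w'
  end.

Definition kauffman_vogel (F : fieldType) (A B a : F) (D : word -> laurent)
    (G : word) (ch : (num_vertices G).-tuple bool) : F :=
  (\sum_(s : (num_vertices G).-tuple (option bool))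
     (- A) ^+ count_mem (Some true) s * (- B) ^+ count_mem (Some false) s
     * laurent_eval a (A - B) (D (resolve ch s G)))%R.

(* The indeterminate A, in the field of rational functions Q(A). *)
Definition varA : {fraction {poly int}} := tofrac 'X%R.

(* Main.v *)
(* The specialization z = A - 1/A, a = A is the SO(2) one: the signs of the
   crossings of an oriented link add up to an integer, and 2 D_L is the sum of A
   to that power over all orientations of the components of L. Expanding the
   vertices, the crossing and its two smoothings cancel unless the edges point
   alternately in and out, so 2 [G] is (- A - 1/A)^v times the sum of A to the
   total crossing sign over the source-sink orientations of G. This sum is
   invariant under regular isotopy, and a curl multiplies it by A or 1/A, just as
   it changes t(G) by 1 or -1. For a planar graph the checkerboard colouring
   identifies source-sink orientations with 2-colourings of the components, of
   which there are 2^c.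

   That D is given by the state sum follows from the uniqueness of the Dubrovnik
   polynomial. A diagram is cut by horizontal lines; by induction from the top, the
   part below a line may be assumed to consist of layered arcs, since a new
   crossing either slides below the top arc, lengthens or shortens it, or has the
   wrong sign and is switched by the skein relation.

   The numbers 2^c and t(G) are read off from similar state sums: the number of
   2-colourings of the components, and the number and the total sign of all
   orientations of the knot-theoretic circuits. *)

From HB Require Import structures.
Require Import Defs.
From mathcomp Require Import zify ring.

Set Implicit Arguments.
Unset Strict Implicit.
Unset Printing Implicit Defensive.

Import GRing.Theory.
Local Open Scope ring_scope.

(** * State sums *)

Lemma run_cat n u v : run n (u ++ v) = obind (run^~ v) (run n u).
Proof. by elim: u n => [|[k i] u IH] n //=; case: ifP. Qed.

Section StateSum.

(* A state labels the strands by booleans. If fl = true it is an orientation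
   (true means upwards, so labels flip at cups and caps) and the signs of the
   crossings are added up in the second component; if fl = false labels are
   colours. At a vertex, vx = true lets the labels go straight ahead, while
   vx = false asks for the same label everywhere (fl = false) or for edges that
   are alternately incoming and outgoing (fl = true). *)
Variables (fl vx : bool).

Definition local_states (k : tile) (m : seq bool) : seq (seq bool * int) :=
  match k, m with
  | Cup, [::] => [:: ([:: true; true (+) fl], 0); ([:: false; fl], 0)]
  | Cap, [:: l; r] => if r == l (+) fl then [:: ([::], 0)] else [::]
  | Cross b, [:: l; r] =>
      [:: ([:: r; l], if fl then crossing_sign b l r else 0)]
  | Vertex, [:: l; r] =>
      if vx then [:: ([:: r; l], 0)]
      else if r == l (+) fl then [:: ([:: l; r], 0)] else [::]
  | _, _ => [::]
  end.

Definition splice (k : tile) (i : nat) (s m : seq bool) : seq bool :=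
  take i s ++ m ++ drop (i + bot k) s.

Definition window (k : tile) (i : nat) (s : seq bool) : seq bool :=
  take (bot k) (drop i s).

Variables (V : nmodType) (g : int -> V).

(** The weight [g] of the total sign is left arbitrary, so that one proof of invariance serves for
    powers of [a] (the polynomial), for constants (the number of states) and for the identity (the
    sum of the signs). *)
Fixpoint state_sum (w : word) (s : seq bool) (e : int) : V :=
  if w is (k, i) :: w' then
    \sum_(o <- local_states k (window k i s))
       state_sum w' (splice k i s o.1) (e + o.2)
  else g e.

End StateSum.

Lemma size_local_states fl vx k m o :
  o \in local_states fl vx k m -> size m = bot k /\ size o.1 = top k.
Proof.
case: k => [||b|]; case: m => [|l [|r [|x m]]] //=; do ?[case: ifP => _];
  rewrite ?inE // => ho; do ?[case/orP: ho => ho]; by rewrite (eqP ho).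
Qed.

Lemma window_cat k i s1 m s2 : size s1 = i -> size m = bot k ->
  window k i (s1 ++ m ++ s2) = m.
Proof. by move=> <- hm; rewrite /window drop_size_cat // -hm take_size_cat. Qed.

Lemma splice_cat k i s1 m s2 m' : size s1 = i -> size m = bot k ->
  splice k i (s1 ++ m ++ s2) m' = s1 ++ m' ++ s2.
Proof.
move=> <- hm; rewrite /splice take_size_cat //; congr (_ ++ (_ ++ _)).
by rewrite catA drop_size_cat // size_cat hm.
Qed.

Lemma split_at (i : nat) (s : seq bool) : (i <= size s)%N ->
  exists s1 s2, s = s1 ++ s2 /\ size s1 = i.
Proof.
by move=> hi; exists (take i s), (drop i s); rewrite cat_take_drop size_takel.
Qed.

Lemma state_sum_consE fl vx (V : nmodType) (g : int -> V) k i w s e :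
  state_sum fl vx g ((k, i) :: w) s e
  = \sum_(o <- local_states fl vx k (window k i s))
      state_sum fl vx g w (splice k i s o.1) (e + o.2).
Proof. by []. Qed.

Lemma state_sum_cons fl vx (V : nmodType) (g : int -> V) k i w s1 m s2 e :
  size s1 = i -> size m = bot k ->
  state_sum fl vx g ((k, i) :: w) (s1 ++ m ++ s2) e
  = \sum_(o <- local_states fl vx k m)
      state_sum fl vx g w (s1 ++ o.1 ++ s2) (e + o.2).
Proof.
move=> hi hm; rewrite state_sum_consE window_cat //.
by apply: eq_bigr => o _; rewrite splice_cat.
Qed.

Arguments state_sum : simpl never.

(** * Invariance of the state sums under the moves *)

Section Moves.

Variables (fl vx : bool) (V : nmodType) (g : int -> V).
Notation ts := (state_sum fl vx g).

Lemma ts_cup i w s1 s2 e : size s1 = i ->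
  ts ((Cup, i) :: w) (s1 ++ s2) e
  = ts w (s1 ++ [:: true, true (+) fl & s2]) e
    + ts w (s1 ++ [:: false, fl & s2]) e.
Proof.
move=> hi; rewrite -[in LHS](cat0s s2) (@state_sum_cons _ _ _ _ Cup) //=.
by rewrite big_cons big_seq1 !addr0.
Qed.

Lemma ts_cap i w s1 l r s2 e : size s1 = i ->
  ts ((Cap, i) :: w) (s1 ++ [:: l, r & s2]) e
  = if r == l (+) fl then ts w (s1 ++ s2) e else 0.
Proof.
move=> hi; rewrite (@state_sum_cons _ _ _ _ Cap _ _ _ [:: l; r]) //=.
by case: ifP => _; rewrite ?big_seq1 ?big_nil ?addr0.
Qed.

Lemma ts_cross b i w s1 l r s2 e : size s1 = i ->
  ts ((Cross b, i) :: w) (s1 ++ [:: l, r & s2]) e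
  = ts w (s1 ++ [:: r, l & s2]) (e + if fl then crossing_sign b l r else 0).
Proof.
move=> hi; rewrite (@state_sum_cons _ _ _ _ (Cross b) _ _ _ [:: l; r]) //=.
by rewrite big_seq1.
Qed.

Lemma ts_vertex i w s1 l r s2 e : size s1 = i ->
  ts ((Vertex, i) :: w) (s1 ++ [:: l, r & s2]) e
  = if vx then ts w (s1 ++ [:: r, l & s2]) e
    else if r == l (+) fl then ts w (s1 ++ [:: l, r & s2]) e else 0.
Proof.
move=> hi; rewrite (@state_sum_cons _ _ _ _ Vertex _ _ _ [:: l; r]) //=.
by case: ifP => _; [|case: ifP => _]; rewrite ?big_seq1 ?big_nil ?addr0.
Qed.

(** This and the next three lemmas restate the rules one position further right over the same [s1],
    so that all letters of a move are evaluated with a single cut of the labels. *)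
Lemma ts_cup1 i w s1 x s2 e : size s1 = i ->
  ts ((Cup, i.+1) :: w) (s1 ++ x :: s2) e
  = ts w (s1 ++ [:: x, true, true (+) fl & s2]) e
    + ts w (s1 ++ [:: x, false, fl & s2]) e.
Proof. by move=> hi; rewrite -cat_rcons ts_cup ?size_rcons ?hi // !cat_rcons. Qed.

Lemma ts_cap1 i w s1 x l r s2 e : size s1 = i ->
  ts ((Cap, i.+1) :: w) (s1 ++ [:: x, l, r & s2]) e
  = if r == l (+) fl then ts w (s1 ++ x :: s2) e else 0.
Proof. by move=> hi; rewrite -cat_rcons ts_cap ?size_rcons ?hi // !cat_rcons. Qed.

Lemma ts_cross1 b i w s1 x l r s2 e : size s1 = i ->
  ts ((Cross b, i.+1) :: w) (s1 ++ [:: x, l, r & s2]) e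
  = ts w (s1 ++ [:: x, r, l & s2]) (e + if fl then crossing_sign b l r else 0).
Proof. by move=> hi; rewrite -cat_rcons ts_cross ?size_rcons ?hi // !cat_rcons. Qed.

Lemma ts_vertex1 i w s1 x l r s2 e : size s1 = i ->
  ts ((Vertex, i.+1) :: w) (s1 ++ [:: x, l, r & s2]) e
  = if vx then ts w (s1 ++ [:: x, r, l & s2]) e
    else if r == l (+) fl then ts w (s1 ++ [:: x, l, r & s2]) e else 0.
Proof. by move=> hi; rewrite -cat_rcons ts_vertex ?size_rcons ?hi // !cat_rcons. Qed.

End Moves.

(** The two letters act on disjoint blocks of labels, [m1] and [m2], so the sums over their local
    states commute and their signs add up in either order. *)
Lemma exchange_state_sum fl vx (V : nmodType) (g : int -> V) p q i j w s e :
  (i + bot p + j + bot q <= size s)%N ->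
  state_sum fl vx g ((q, i + bot p + j)%N :: (p, i) :: w) s e
  = state_sum fl vx g ((p, i) :: (q, i + top p + j)%N :: w) s e.
Proof.
move=> hs.
have [s1 [r1 [def_s sz1]]] := @split_at i s ltac:(lia).
have [m1 [r2 [def_r1 szm1]]] := @split_at (bot p) r1
  ltac:(move: hs; rewrite def_s size_cat; lia).
have [s2 [r3 [def_r2 sz2]]] := @split_at j r2
  ltac:(move: hs; rewrite def_s def_r1 !size_cat; lia).
have [m2 [s3 [def_r3 szm2]]] := @split_at (bot q) r3
  ltac:(move: hs; rewrite def_s def_r1 def_r2 !size_cat; lia).
rewrite {}def_s {}def_r1 {}def_r2 {}def_r3 {r1 r2 r3 s hs}.
have -> : s1 ++ m1 ++ s2 ++ m2 ++ s3 = (s1 ++ m1 ++ s2) ++ m2 ++ s3.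
  by rewrite -!catA.
rewrite state_sum_cons // ?size_cat ?szm1 ?sz1 ?sz2 ?addnA //.
under eq_bigr => o _.
  rewrite -!catA state_sum_cons //.
  over.
rewrite -!catA state_sum_cons //= exchange_big /=.
rewrite [LHS]big_seq [RHS]big_seq; apply: eq_bigr => o /size_local_states[_ szo].
have E : s1 ++ o.1 ++ s2 ++ m2 ++ s3 = (s1 ++ o.1 ++ s2) ++ m2 ++ s3.
  by rewrite -!catA.
rewrite E state_sum_cons ?size_cat ?sz1 ?szo ?sz2 ?addnA //.
by apply: eq_bigr => o' _; rewrite -!catA addrAC.
Qed.

Ltac ts_simpl hs :=
  repeat first
  [ rewrite (@ts_cup _ _ _ _ _ _ _ _ _ hs) /=
  | rewrite (@ts_cap _ _ _ _ _ _ _ _ _ _ _ hs) /=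
  | rewrite (@ts_cross _ _ _ _ _ _ _ _ _ _ _ _ hs) /=
  | rewrite (@ts_vertex _ _ _ _ _ _ _ _ _ _ _ hs) /=
  | rewrite (@ts_cup1 _ _ _ _ _ _ _ _ _ _ hs) /=
  | rewrite (@ts_cap1 _ _ _ _ _ _ _ _ _ _ _ _ hs) /=
  | rewrite (@ts_cross1 _ _ _ _ _ _ _ _ _ _ _ _ _ hs) /=
  | rewrite (@ts_vertex1 _ _ _ _ _ _ _ _ _ _ _ _ hs) /=].

Section Invariance.

Variables (fl vx : bool) (V : nmodType) (g : int -> V).
Notation ts := (state_sum fl vx g).

(** Apart from the exchange, at most three adjacent labels are involved, and the equality is checked
    for each of their values. In a zigzag the cap keeps exactly one of the two states of the cup. *)
Lemma state_sum_planar x y w s e m m' : planar_move x y ->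
  run (size s) x = Some m -> run (size s) y = Some m' ->
  ts (x ++ w) s e = ts (y ++ w) s e.
Proof.
case=> [p q i j|i|i|k i hk|k i hk] /=.
- by case: ifP => // hs _ _; apply: exchange_state_sum; lia.
- case: ifP => // h1; case: ifP => // h2 _ _.
  have [s1 [[|a r] [def_s hs1]]] := @split_at i s ltac:(lia).
    by move: h2; rewrite def_s size_cat /=; lia.
  by rewrite {}def_s; ts_simpl hs1; case: a fl => [] [] /=; rewrite ?addr0 ?add0r.
- case: ifP => // h1; case: ifP => // h2 _ _.
  have [s1 [[|a r] [def_s hs1]]] := @split_at i s ltac:(lia).
    by move: h1; rewrite def_s size_cat /=; lia.
  by rewrite {}def_s; ts_simpl hs1; case: a fl => [] [] /=; rewrite ?addr0 ?add0r.
- case: ifP => // h1 _; case: ifP => // h2 _.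
  have [s1 [[|a r] [def_s hs1]]] := @split_at i s ltac:(lia).
    by move: h2; rewrite def_s size_cat /=; lia.
  rewrite {}def_s; case: k hk {h1 h2} => [||b|] //= _; ts_simpl hs1.
    by case: b a fl => [] [] [] //=; rewrite addrC.
  by case: fl vx a => [] [] [] //=; rewrite ?addr0 ?add0r.
case: ifP => // h1; case: ifP => // h2 _.
have [s1 [[|a [|b [|c r]]] [def_s hs1]]] := @split_at i s ltac:(lia);
  try by move: h1; rewrite def_s size_cat /=; case: k hk {h2} => //=; lia.
rewrite {}def_s; case: k hk {h1 h2} => [||b'|] //= _; ts_simpl hs1.
  by case: b' a b c fl => [] [] [] [] [] //=.
by case: fl vx a b c => [] [] [] [] [] //=; rewrite ?addr0 ?add0r.
Qed.

(** In the third and fourth moves the same signs occur in another order; in the second and fifth the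
    two crossings have opposite signs for every admissible state. *)
Lemma state_sum_regular x y w s e m m' : regular_move x y ->
  run (size s) x = Some m -> run (size s) y = Some m' ->
  ts (x ++ w) s e = ts (y ++ w) s e.
Proof.
have rowsP i k : (i + k <= size s)%N -> exists s1 s2,
  [/\ s = s1 ++ s2, size s1 = i & (k <= size s2)%N].
  move=> hk; have [s1 [s2 [hs hs1]]] := @split_at i s ltac:(lia).
  by exists s1, s2; split=> //; move: hk; rewrite hs size_cat; lia.
case=> [|[b i]|[b12 b13 b23 i hb]|[[b i|b i]|[b i]]] /=.
- exact: state_sum_planar.
- case: ifP => // h1 _ _; have [s1 [[|l [|r s2]] [-> hs1 //]]] := rowsP i 2%N h1.
  ts_simpl hs1 => _; congr (ts _ _ _).
  by case: b l r fl => [] [] [] []; rewrite /crossing_sign /= ?addr0 ?addrK ?subrK.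
- case: ifP => // h1; case: ifP => // h2 _ _.
  have [s1 [[|a [|b [|c s2]]] [-> hs1 //]]] := rowsP i 3%N ltac:(lia).
  by ts_simpl hs1 => _; congr (ts _ _ _); ring.
- case: ifP => // h1; case: ifP => // h2 _ _.
  have [s1 [[|x1 [|x2 [|x3 s2]]] [-> hs1 //]]] := rowsP i 3%N ltac:(lia).
  ts_simpl hs1 => _; rewrite /crossing_sign.
  by case: b x1 x2 x3 fl vx => [] [] [] [] [] [] //=; rewrite ?addr0 ?addrK ?subrK.
- case: ifP => // h1; case: ifP => // h2 _ _.
  have [s1 [[|x1 [|x2 [|x3 s2]]] [-> hs1 //]]] := rowsP i 3%N ltac:(lia).
  ts_simpl hs1 => _; rewrite /crossing_sign.
  by case: b x1 x2 x3 fl vx => [] [] [] [] [] [] //=; rewrite ?addr0 ?addrK ?subrK.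
- case: ifP => // h1 _ _; have [s1 [[|l [|r s2]] [-> hs1 //]]] := rowsP i 2%N ltac:(lia).
  ts_simpl hs1 => _; rewrite /crossing_sign.
  by case: b l r fl vx => [] [] [] [] [] //=; rewrite ?addr0 ?addrK ?subrK.
Qed.

End Invariance.

(** The crossing of a curl has the same sign for both orientations of the strand, and the cap keeps
    one of the two states of the cup. *)
Lemma state_sum_curl fl vx (V : nmodType) (g : int -> V) left b i w s e m :
  run (size s) (curl left b i) = Some m ->
  state_sum fl vx g (curl left b i ++ w) s e
  = state_sum fl vx g w s (e + if fl then (if b then 1 else -1) else 0).
Proof.
move=> hrun.
have [s1 [s2 [def_s hs1]]] := @split_at i s
  ltac:(move: hrun; rewrite /curl; case: (left) => /=; case: ifP => //; lia).
case: s2 def_s => [|a s2] def_s.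
  by move: hrun; rewrite def_s size_cat hs1 /curl; case: (left) => /=;
    do ?[case: ifP => //]; lia.
rewrite def_s /curl; case: (left); rewrite /=; ts_simpl hs1;
  by rewrite /crossing_sign; case: b a fl {hrun def_s} => [] [] [] /=;
    rewrite ?addr0 ?add0r.
Qed.

(** The letters of [u] only select the labels at the level where [x] and [y] begin, so a comparison
    made there for all labels carries down to the bottom. The shift [c] allows for the sign of a
    curl. *)
Lemma state_sum_prefix fl vx (V : nmodType) (g : int -> V) (c : int) u x y n k :
    run n u = Some k ->
    (forall s e, size s = k ->
       state_sum fl vx g x s e = state_sum fl vx g y s (e + c)) ->
  forall s e, size s = n ->
  state_sum fl vx g (u ++ x) s e = state_sum fl vx g (u ++ y) s (e + c).
Proof.
elim: u n => [n [->] //|[t i] u IH n /=]; case: ifP => // hi hu H s e hs.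
have [s1 [r [def_s hs1]]] := @split_at i s ltac:(lia).
have [m [s2 [def_r hm]]] := @split_at (bot t) r
  ltac:(move: hi; rewrite -hs def_s size_cat; lia).
rewrite def_s def_r !state_sum_cons // [LHS]big_seq [RHS]big_seq.
apply: eq_bigr => o /size_local_states[_ ho]; rewrite [e + c + _]addrAC.
apply: IH hu H _ _ _; rewrite !size_cat ho -hs def_s def_r !size_cat; lia.
Qed.

Lemma num_vertices_cat u v :
  num_vertices (u ++ v) = (num_vertices u + num_vertices v)%N.
Proof. by rewrite /num_vertices count_cat. Qed.

Lemma num_vertices_move x y : ambient_move x y ->
  num_vertices x = num_vertices y.
Proof.
by case=> [[[[||b|] [||b'|] i j|i|i|[||b|] i|[||b|] i]|[b i]
  |[b12 b13 b23 i hb]|[[b i|b i]|[b i]]]|[[] b i]].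
Qed.

Lemma regular_state_sum fl vx (V : nmodType) (g : int -> V) u x y v e :
    regular_move x y ->
    run 0 (u ++ x ++ v) = Some 0%N -> run 0 (u ++ y ++ v) = Some 0%N ->
  state_sum fl vx g (u ++ x ++ v) [::] e = state_sum fl vx g (u ++ y ++ v) [::] e.
Proof.
move=> hxy; rewrite !run_cat; case hu: run => [n|] //=; rewrite !run_cat.
case hx: run => [k|] //= _; case hy: run => [k'|] //= _.
rewrite (@state_sum_prefix fl vx V g 0 u _ (y ++ v) 0 n) ?addr0 // => s e' hs.
by rewrite addr0; apply: state_sum_regular hxy _ _; rewrite hs; eassumption.
Qed.

Lemma curl_state_sum fl vx (V : nmodType) (g : int -> V) u left b i v e :
    run 0 (u ++ curl left b i ++ v) = Some 0%N ->
  state_sum fl vx g (u ++ curl left b i ++ v) [::] e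
  = state_sum fl vx g (u ++ v) [::]
      (e + if fl then (if b then 1 else -1) else 0).
Proof.
rewrite run_cat; case hu: run => [n|] //=; rewrite run_cat.
case hx: run => [k|] //= _; apply: (@state_sum_prefix _ _ _ _ _ _ _ _ 0 n) => // s e' hs.
by apply: state_sum_curl; rewrite hs; exact: hx.
Qed.

(** The shift [c] is the signed number of curls that the isotopy takes away. It does not depend on
    [vx], [V] or [g], so the exponent gained by the source-sink sum is the one gained by the
    orientations of the circuits, from which the twisting number is read off. *)
Lemma ambient_state_sum w w' : ambient_isotopic w w' ->
  num_vertices w = num_vertices w' /\
  exists c : int, forall fl vx (V : nmodType) (g : int -> V) e,
    state_sum fl vx g w [::] e
    = state_sum fl vx g w' [::] (e + if fl then c else 0).
Proof.
elim=> {w w'} [_ _ [u x y v hxy hx hy]|w|w w' _ [hv [c H]]|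
  w1 w2 w3 _ [hv12 [c12 H12]] _ [hv23 [c23 H23]]].
- move: hx hy => /andP[_ /eqP hx] /andP[_ /eqP hy]; split.
    by rewrite !num_vertices_cat (num_vertices_move hxy).
  case: hxy hx hy => [hxy|[left b i]] hx hy.
    by exists 0 => fl vx V g e; rewrite if_same addr0; apply: regular_state_sum.
  by exists (if b then 1 else -1) => fl vx V g e; apply: curl_state_sum.
- by split=> //; exists 0 => fl vx V g e; rewrite if_same addr0.
- split=> //; exists (- c) => fl vx V g e; rewrite H.
  by case: fl; rewrite ?subrK ?addr0.
split; first by rewrite hv12.
by exists (c12 + c23) => fl vx V g e; rewrite H12 H23 -addrA; case: fl.
Qed.

(** * Checkerboard colouring *)

Fixpoint alternate (b : bool) (s : seq bool) : seq bool :=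
  if s is x :: s' then (x (+) b) :: alternate (~~ b) s' else [::].

Lemma size_alternate b s : size (alternate b s) = size s.
Proof. by elim: s b => //= x s IH b; rewrite IH. Qed.

Lemma alternate_cat b s1 s2 :
  alternate b (s1 ++ s2) = alternate b s1 ++ alternate (b (+) odd (size s1)) s2.
Proof.
elim: s1 b => [|x s1 IH] b /=; first by rewrite addbF.
by rewrite IH addbN addNb.
Qed.

Lemma alternate_eq d x1 x2 :
  (x2 (+) ~~ d == x1 (+) d (+) false) = (x2 == ~~ x1).
Proof. by case: d x1 x2 => [] [] []. Qed.

(* Checkerboard colouring: on a crossingless diagram, changing the orientation
   of every second strand turns source-sink orientations of the graph into
   2-colourings of its components. *)
Lemma state_sum_alternate b (V : nmodType) (g : int -> V) w s e m :
    ~~ has (fun l => is_cross l.1) w -> run (size s) w = Some m ->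
  state_sum true false g w s e = state_sum false false g w (alternate b s) e.
Proof.
elim: w s => //= -[t i] w IH s; rewrite negb_or => /andP[/= ht hw].
case: ifP => // hi hrun.
have [s1 [r [def_s hs1]]] := @split_at i s ltac:(lia).
have hs1' d : size (alternate d s1) = i by rewrite size_alternate.
have {IH} H s' : size s' = (size s - bot t + top t)%N ->
  state_sum true false g w s' e = state_sum false false g w (alternate b s') e.
  by move=> hs'; apply: IH => //; rewrite hs'.
have hr : (bot t <= size r)%N by move: hi; rewrite def_s size_cat; lia.
(* Cups, caps and vertices change the number of strands by an even number, so the parities to the
   right of the letter are preserved. *)
rewrite def_s alternate_cat; case: t ht hi hrun H hr => [||b'|] //= _ hi hrun H hr.
- ts_simpl hs1; ts_simpl (hs1' b).
  rewrite !H ?def_s ?size_cat /= ?size_cat /=; try lia.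
  (* If the left strand of the cup is among the flipped ones, the two states of the cup change
     places. *)
  rewrite !alternate_cat /=; case: (b (+) _) => //=; exact: addrC.
- case: r def_s hr => [|x1 [|x2 s2]] // def_s _ /=.
  ts_simpl hs1; ts_simpl (hs1' b).
  rewrite alternate_eq addbT; case: ifP => // _.
  rewrite H; last by rewrite def_s !size_cat /=; lia.
  by rewrite alternate_cat /= ?negbK ?hs1.
case: r def_s hr => [|x1 [|x2 s2]] // def_s _ /=.
ts_simpl hs1; ts_simpl (hs1' b).
rewrite alternate_eq addbT; case: ifP => // _.
rewrite H; last by rewrite def_s !size_cat /=; lia.
  by rewrite alternate_cat /= ?negbK ?hs1.
Qed.

Local Close Scope ring_scope.

(** * Uniqueness of skein invariants *)

Definition vertexless (w : word) : bool := ~~ has (fun l => is_vertex l.1) w.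

(** Unlike [link_diagram], this admits the empty word, where the induction starts. *)
Definition link_word (w : word) : bool := vertexless w && (run 0 w == Some 0).

(** Two properties are fed into the induction: the vanishing of the defect of a Dubrovnik
    polynomial, and the nonvanishing of a number of orientations. Curls, circles and crossings
    therefore only ask for an implication, from the other diagrams of the relation to the given
    one. *)
Record skein_closed (P : word -> Prop) : Prop := SkeinClosed {
  skein_closed_nil : P [::];
  skein_closed_regular : forall u x y v, regular_move x y ->
    link_word (u ++ x ++ v) -> link_word (u ++ y ++ v) ->
    (P (u ++ x ++ v) <-> P (u ++ y ++ v));
  skein_closed_curl : forall u v left b i,
    link_word (u ++ v) -> link_word (u ++ curl left b i ++ v) ->
    P (u ++ v) -> P (u ++ curl left b i ++ v);
  skein_closed_circle : forall u v i,
    link_word (u ++ v) -> link_word (u ++ [:: (Cup, i), (Cap, i) & v]) ->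
    P (u ++ v) -> P (u ++ [:: (Cup, i), (Cap, i) & v]);
  skein_closed_skein : forall u v b i,
    link_word (u ++ (Cross b, i) :: v) ->
    P (u ++ (Cross (~~ b), i) :: v) -> P (u ++ v) ->
    P (u ++ [:: (Cap, i), (Cup, i) & v]) -> P (u ++ (Cross b, i) :: v)
}.

Ltac run_tac := rewrite /=; do ?[rewrite ifT; last lia]; rewrite //=;
  try (congr Some; lia).

Section SkeinInduction.

Variables (P : word -> Prop) (hP : skein_closed P).

(** Contextual equivalence for [P] above [n] strands; the first two conditions ensure that replacing
    [x] by [y] preserves link words. *)
Definition skein_eq (n : nat) (x y : word) : Prop :=
  [/\ vertexless x = vertexless y, run n x = run n y &
   forall u v, run 0 u = Some n ->
     link_word (u ++ x ++ v) -> (P (u ++ x ++ v) <-> P (u ++ y ++ v))].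

Lemma vertexless_cat u v : vertexless (u ++ v) = vertexless u && vertexless v.
Proof. by rewrite /vertexless has_cat negb_or. Qed.

Lemma skein_eq_refl n x : skein_eq n x x.
Proof. by []. Qed.

Lemma link_word_eq n x y u v : vertexless x = vertexless y ->
  run n x = run n y -> run 0 u = Some n ->
  link_word (u ++ x ++ v) = link_word (u ++ y ++ v).
Proof.
by move=> h1 h2 h3; rewrite /link_word !vertexless_cat h1 !run_cat h3 /= !run_cat h2.
Qed.

Lemma skein_eq_sym n x y : skein_eq n x y -> skein_eq n y x.
Proof.
case=> h1 h2 h3; split=> // u v hu; rewrite -(link_word_eq v h1 h2 hu) => h.
by case: (h3 u v hu h).
Qed.

Lemma skein_eq_trans n y x z : skein_eq n x y -> skein_eq n y z -> skein_eq n x z.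
Proof.
case=> h1 h2 h3 [k1 k2 k3]; split; rewrite ?h1 ?h2 // => u v hu h.
by rewrite (h3 u v hu h) k3 -?(link_word_eq v h1 h2 hu).
Qed.

Lemma skein_eq_ctx n m u x y v : run n u = Some m ->
  skein_eq m x y -> skein_eq n (u ++ x ++ v) (u ++ y ++ v).
Proof.
move=> hu [h1 h2 h3]; split.
- by rewrite !vertexless_cat h1.
- by rewrite !run_cat hu /= !run_cat h2.
move=> u' v' hu'; rewrite -!catA !(catA u'); apply: h3.
by rewrite run_cat hu'.
Qed.

Lemma skein_eq_move n x y : regular_move x y -> vertexless x -> vertexless y ->
  isSome (run n x) -> run n x = run n y -> skein_eq n x y.
Proof.
move=> hxy hx hy _ hr; split; rewrite ?hx ?hy // => u v hu h.
apply: (skein_closed_regular hP) => //.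
by rewrite -(link_word_eq v _ hr hu) ?hx ?hy.
Qed.

Lemma skein_eq_cons n m l x y : run n [:: l] = Some m ->
  skein_eq m x y -> skein_eq n (l :: x) (l :: y).
Proof.
by move=> hl /(skein_eq_ctx [::] hl); rewrite !cats0.
Qed.

Lemma skein_eq_catr n x y v : skein_eq n x y -> skein_eq n (x ++ v) (y ++ v).
Proof. exact: (@skein_eq_ctx n n [::] x y v). Qed.

Lemma skein_eq_catl n m u x y : run n u = Some m ->
  skein_eq m x y -> skein_eq n (u ++ x) (u ++ y).
Proof. by move=> hu /(skein_eq_ctx [::] hu); rewrite !cats0. Qed.

Ltac by_move m := apply: skein_eq_move;
  [first [apply: Or41; exact: m | apply: Or42; exact: m | apply: Or43; exact: m]
  | by [] | by [] | run_tac | run_tac].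

Lemma skein_eq_exchange n p q i j :
    ~~ is_vertex p -> ~~ is_vertex q -> (i + bot p + j + bot q <= n)%N ->
  skein_eq n [:: (q, i + bot p + j)%N; (p, i)] [:: (p, i); (q, i + top p + j)%N].
Proof.
move=> /negbTE hp /negbTE hq h; apply: skein_eq_move.
- by apply: Or41; apply: PM_exchange.
- by rewrite /vertexless /= hp hq.
- by rewrite /vertexless /= hp hq.
- by run_tac.
run_tac.
Qed.

Lemma skein_eq_zigzag_l n i : (i < n)%N ->
  skein_eq n [:: (Cup, i); (Cap, i.+1)] [::].
Proof. by move=> h; by_move (PM_zigzag_l i). Qed.

Lemma skein_eq_zigzag_r n i : (i < n)%N ->
  skein_eq n [:: (Cup, i.+1); (Cap, i)] [::].
Proof. by move=> h; by_move (PM_zigzag_r i). Qed.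

Lemma skein_eq_slide_cup n b i : (i < n)%N ->
  skein_eq n [:: (Cup, i); (Cross b, i.+1)] [:: (Cup, i.+1); (Cross (~~ b), i)].
Proof. by move=> h; by_move (@PM_slide_cup (Cross b) i isT). Qed.

Lemma skein_eq_slide_cap n b i : (i + 2 < n)%N ->
  skein_eq n [:: (Cross b, i.+1); (Cap, i)] [:: (Cross (~~ b), i); (Cap, i.+1)].
Proof. by move=> h; by_move (@PM_slide_cap (Cross b) i isT). Qed.

Lemma skein_eq_move2 n b i : (i + 1 < n)%N ->
  skein_eq n [:: (Cross b, i); (Cross (~~ b), i)] [::].
Proof. by move=> h; by_move (M2 b i). Qed.

Lemma skein_eq_move3 n b i : (i + 2 < n)%N ->
  skein_eq n [:: (Cross true, i); (Cross true, i.+1); (Cross b, i)]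
    [:: (Cross b, i.+1); (Cross true, i); (Cross true, i.+1)].
Proof. by move=> h; by_move (@M3 true true b i isT). Qed.

(* The strand p moves to the right over the next d strands. *)
Definition over (p d : nat) : word := [seq (Cross true, q) | q <- iota p d].

(* The strand p + d moves to the left over the d strands before it. *)
Definition over_left (p d : nat) : word :=
  [seq (Cross false, q) | q <- rev (iota p d)].

Lemma overD p d1 d2 : over p (d1 + d2) = over p d1 ++ over (p + d1) d2.
Proof. by rewrite /over iotaD map_cat. Qed.

Lemma overSr p d : over p d.+1 = rcons (over p d) (Cross true, (p + d)%N).
Proof. by rewrite -addn1 overD cats1. Qed.

Lemma over_leftS p d : over_left p d.+1 = (Cross false, (p + d)%N) :: over_left p d.
Proof. by rewrite /over_left -addn1 iotaD rev_cat. Qed.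

Lemma vertexless_over p d : vertexless (over p d).
Proof. by rewrite /vertexless /over has_map has_pred0. Qed.

Lemma run_over n p d : (p + d < n)%N -> run n (over p d) = Some n.
Proof.
elim: d p => //= d IH p h; rewrite ifT; last lia.
rewrite subnK; last lia.
by apply: IH; lia.
Qed.

Lemma over_comm_left n k i p d : ~~ is_vertex k ->
    (i <= p)%N -> (p + bot k + d < n)%N ->
  skein_eq n (rcons (over (p + bot k) d) (k, i)) ((k, i) :: over (p + top k) d).
Proof.
move=> hk hi; elim: d p hi => [|d IH] p hi h; first exact: skein_eq_refl.
rewrite /over /= -/(over _ _).
apply: (@skein_eq_trans _
  [:: (Cross true, (p + bot k)%N), (k, i) & over (p + top k).+1 d]).
  apply: (@skein_eq_cons _ n); first by run_tac.
  by have := IH p.+1; rewrite !addSn; apply; lia.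
have := @skein_eq_exchange n k (Cross true) i (p - i) hk isT.
have -> : (i + bot k + (p - i) = p + bot k)%N by lia.
have -> : (i + top k + (p - i) = p + top k)%N by lia.
by move=> /(_ ltac:(rewrite /=; lia)) /(skein_eq_catr (over (p + top k).+1 d)).
Qed.

Lemma over_comm_right n k i p d : ~~ is_vertex k ->
    (p + d < i)%N -> (i + bot k <= n)%N ->
  skein_eq n (rcons (over p d) (k, i)) ((k, i) :: over p d).
Proof.
move=> hk; elim: d p => [|d IH] p hi h; first exact: skein_eq_refl.
rewrite /over /= -/(over _ _).
apply: (@skein_eq_trans _ [:: (Cross true, p), (k, i) & over p.+1 d]).
  apply: (@skein_eq_cons _ n); first by run_tac.
  by apply: IH; lia.
have := @skein_eq_exchange n (Cross true) k p (i - p - 2) isT hk.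
have -> : (p + bot (Cross true) + (i - p - 2) = i)%N by rewrite /=; lia.
by move=> /(_ h) /skein_eq_sym /(skein_eq_catr (over p.+1 d)).
Qed.

(** The crossings slide one by one across the maximum: instead of its left leg running over the [d]
    strands in between, its right leg does. *)
Lemma over_cap n p d : (p + d + 1 < n)%N ->
  skein_eq n (rcons (over p d) (Cap, p + d)%N) (rcons (over_left p.+1 d) (Cap, p)).
Proof.
elim: d => [|d IH] h; first by rewrite addn0; apply: skein_eq_refl.
rewrite overSr over_leftS addnS -!cats1 -catA.
apply: (@skein_eq_trans _ (over p d ++ [:: (Cross false, (p + d).+1); (Cap, p + d)%N])).
  apply: (@skein_eq_catl _ n); first by apply: run_over; lia.
  by apply/skein_eq_sym/skein_eq_slide_cap; lia.
rewrite addSn /=.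
apply: (@skein_eq_trans _ ((Cross false, (p + d).+1) :: over p d ++ [:: (Cap, p + d)%N])).
  rewrite -cat_rcons; apply: (@skein_eq_catr n _ (_ :: over p d)).
  by apply: over_comm_right => //=; lia.
apply: (@skein_eq_cons _ n); first by run_tac.
by rewrite !cats1; apply: IH; lia.
Qed.

Lemma cup_over_left n p d : (p + d < n)%N ->
  skein_eq n ((Cup, p) :: over_left p.+2 d) (rcons (over_left p d) (Cup, p)).
Proof.
elim: d => [|d IH] h; first exact: skein_eq_refl.
rewrite !over_leftS /=.
apply: (@skein_eq_trans _ [:: (Cross false, (p + d)%N), (Cup, p) & over_left p.+2 d]).
  have := @skein_eq_exchange n Cup (Cross false) p d isT isT.
  rewrite /= addn0 => /(_ ltac:(lia)) /skein_eq_sym.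
  by move=> /(skein_eq_catr (over_left p.+2 d)); rewrite addn2.
apply: (@skein_eq_cons _ n); first by run_tac.
by apply: IH; lia.
Qed.

(** A letter among strands that have been passed over can be pulled underneath the passing strand:
    for a crossing this is the third Reidemeister move, for a cap a slide followed by the second. *)
Lemma over_through n k i p d : ~~ is_vertex k -> k <> Cup ->
    (p <= i)%N -> (i + bot k <= p + d)%N -> (p + d < n)%N ->
  skein_eq n (rcons (over p d) (k, i)) ((k, i.+1) :: over p (d - bot k + top k)).
Proof.
move=> hk hk' hpi hi h.
(* The strands passed over are split into those to the left of [k], those entering [k] and those to
   its right. *)
have hd : d = (i - p + (bot k + (d - (i - p) - bot k)))%N by lia.
set d1 := (i - p)%N in hd; set d2 := (d - d1 - bot k)%N in hd.
have hpd : (p + d1 = i)%N by lia.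
have -> : (d - bot k + top k = d1 + (top k + d2))%N by lia.
rewrite [in over p d]hd !overD !hpd -!cats1 -!catA.
apply: (@skein_eq_trans _ (over p d1 ++ over i (bot k) ++ (k, i) :: over (i + top k) d2)).
  apply: (@skein_eq_catl _ n); first by apply: run_over; lia.
  apply: (@skein_eq_catl _ n); first by apply: run_over; lia.
  by rewrite cats1; apply: over_comm_left => //; lia.
rewrite -(cat1s (k, i)).
apply: (@skein_eq_trans _
  (over p d1 ++ [:: (k, i.+1)] ++ over i (top k) ++ over (i + top k) d2)).
  apply: (@skein_eq_catl _ n); first by apply: run_over; lia.
  rewrite 2!catA; apply: skein_eq_catr.
  case: k hk' hk hi @d2 hd h => //= [|b] _ _ hi hd h.
    apply: (@skein_eq_trans _ [:: (Cross true, i); (Cross false, i); (Cap, i.+1)]).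
      apply: (@skein_eq_cons _ n); first by run_tac.
      by apply: skein_eq_slide_cap; lia.
    by apply: (skein_eq_catr [:: (Cap, i.+1)] (@skein_eq_move2 n true i _)); lia.
  by apply: skein_eq_move3; lia.
rewrite catA -cat_cons; apply: skein_eq_catr.
by rewrite cats1; apply: over_comm_right => //; lia.
Qed.

(** A minimum whose right leg then runs over the next [d] strands: its ends lie at the positions [j]
    and [j + d + 1]. *)
Definition arc (j d : nat) : word := (Cup, j) :: over j.+1 d.

(* Diagrams stacked from arcs, each one lying over all the previous ones. *)
Inductive layered : nat -> word -> Prop :=
| Layered_nil : layered 0 [::]
| Layered_arc n u j d : layered n u -> (j + d <= n)%N ->
    layered n.+2 (u ++ arc j d).

Lemma run_arc n j d : (j + d <= n)%N -> run n (arc j d) = Some n.+2.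
Proof.
move=> h; rewrite /= ifT; last lia.
by rewrite subn0 addn2 run_over //; lia.
Qed.

Lemma vertexless_arc j d : vertexless (arc j d).
Proof. exact: (vertexless_over j.+1 d). Qed.

Lemma layered_run n u : layered n u -> run 0 u = Some n /\ vertexless u.
Proof.
elim=> // {}n {}u j d _ [hu vu] h; rewrite run_cat hu /= -/(arc j d).
by rewrite -(run_arc h) vertexless_cat vu vertexless_arc.
Qed.

(** The statement carried by the induction from the top. It quantifies over all layered lower parts
    because absorbing a letter changes the arcs below it. *)
Definition good_top (n : nat) (t : word) : Prop :=
  [/\ vertexless t, run n t = Some 0 & forall u, layered n u -> P (u ++ t)].

Lemma good_top_layered n j d t : good_top n.+2 t -> (j + d <= n)%N ->
  good_top n (arc j d ++ t).
Proof.
case=> ht rt H h; split.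
- by rewrite vertexless_cat ht vertexless_arc.
- by rewrite run_cat run_arc.
by move=> w hw; rewrite catA; apply: H; apply: Layered_arc.
Qed.

Lemma good_top_cup n i t : (i <= n)%N -> good_top n.+2 t -> good_top n ((Cup, i) :: t).
Proof.
by move=> hi ht; apply: (@good_top_layered n i 0 t ht); rewrite addn0.
Qed.

Lemma layered_skein_eq n u x y t : layered n u -> skein_eq n x y ->
  vertexless (x ++ t) -> run n (x ++ t) = Some 0 -> P (u ++ y ++ t) -> P (u ++ x ++ t).
Proof.
move=> /layered_run[hu vu] [h1 h2 h3] vt rt; apply: (proj2 (h3 u t hu _)).
by rewrite /link_word vertexless_cat vu vt run_cat hu /= rt.
Qed.

Lemma layered_inv n w : layered n w -> (n = 0 /\ w = [::]) \/
  exists m u j d, [/\ n = m.+2, w = u ++ arc j d, layered m u & (j + d <= m)%N].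
Proof. by case=> [|m u j d hu h]; [left | right; exists m, u, j, d]. Qed.

Lemma arc_disjoint n k i j d : ~~ is_vertex k -> bot k = 2 ->
    (j + d <= n)%N -> (i + 2 <= n.+2)%N ->
    [|| i + 1 < j, j + d + 1 < i | (j < i) && (i < j + d)]%N ->
  exists i' j' d', [/\ (i' + 2 <= n)%N, (j' + d' <= n - 2 + top k)%N &
    skein_eq n (rcons (arc j d) (k, i)) ((k, i') :: arc j' d')].
Proof.
move=> hk bk hjd hi.
have hcup m : (m <= n)%N -> run n [:: (Cup, m)] = Some n.+2.
  by move=> hm; rewrite /= ifT ?subn0 ?addn2 //; lia.
case: (ltnP (i + 1) j) => [h1 _|h1 /= hcases].
  exists i, (j - 2 + top k)%N, d; split; try lia.
  apply: (@skein_eq_trans _ [:: (Cup, j), (k, i) & over (j - 1 + top k) d]).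
    apply: (skein_eq_cons (hcup j _)); first lia.
    rewrite (_ : j.+1 = j - 1 + bot k)%N; last lia.
    by apply: over_comm_left => //; lia.
  have := @skein_eq_exchange n k Cup i (j - 2 - i) hk isT.
  have -> : (i + bot k + (j - 2 - i) = j)%N by lia.
  have -> : (i + top k + (j - 2 - i) = j - 2 + top k)%N by lia.
  move=> /(_ ltac:(rewrite /=; lia)) /(skein_eq_catr (over (j - 1 + top k) d)).
  by rewrite /arc (_ : (j - 2 + top k).+1 = j - 1 + top k)%N //; lia.
case: (ltnP (j + d + 1) i) hcases => [h2 _|h2 /= /andP[h3 h4]].
  exists (i - 2)%N, j, d; split; try lia.
  apply: (@skein_eq_trans _ [:: (Cup, j), (k, i) & over j.+1 d]).
    apply: (skein_eq_cons (hcup j _)); first lia.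
    by apply: over_comm_right => //; lia.
  have := @skein_eq_exchange n Cup k j (i - 2 - j) isT hk.
  rewrite /= addn0 bk.
  have -> : (j + (i - 2 - j) = i - 2)%N by lia.
  have -> : (j + 2 + (i - 2 - j) = i)%N by lia.
  by move=> /(_ ltac:(lia)) /skein_eq_sym /(skein_eq_catr (over j.+1 d)).
exists (i - 1)%N, j, (d - 2 + top k)%N; split; try lia.
apply: (@skein_eq_trans _ [:: (Cup, j), (k, i.+1) & over j.+1 (d - bot k + top k)]).
  apply: (skein_eq_cons (hcup j _)); first lia.
  by apply: over_through => //; [by move=> ek; rewrite ek in bk| lia..].
have := @skein_eq_exchange n Cup k j (i - 1 - j) isT hk.
rewrite /= addn0 bk.
have -> : (j + (i - 1 - j) = i - 1)%N by lia.
have -> : (j + 2 + (i - 1 - j) = i.+1)%N by lia.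
move=> /(_ ltac:(lia)) /skein_eq_sym.
by move=> /(skein_eq_catr (over j.+1 (d - 2 + top k))).
Qed.

(** A crossing of the two legs of a maximum is, up to planar isotopy, a kink in the left leg; the
    quarter turn changes [b]. The next lemma is the analogue for a minimum. *)
Lemma curl_cap n b i : (i + 2 <= n)%N ->
  skein_eq n [:: (Cross b, i); (Cap, i)] (curl true (~~ b) i ++ [:: (Cap, i)]).
Proof.
move=> h; apply: skein_eq_sym.
apply: (@skein_eq_trans _ [:: (Cup, i); (Cross (~~ b), i.+1); (Cap, i.+2); (Cap, i)]).
  apply: (@skein_eq_cons _ n.+2); first by run_tac.
  apply: (@skein_eq_cons _ n.+2); first by run_tac.
  have := @skein_eq_exchange n.+2 Cap Cap i 0 isT isT.
  by rewrite /= !addn0 !addn2 => /(_ ltac:(lia)) /skein_eq_sym.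
apply: (@skein_eq_trans _ [:: (Cup, i); (Cross b, i.+2); (Cap, i.+1); (Cap, i)]).
  apply: (@skein_eq_cons _ n.+2); first by run_tac.
  apply: (@skein_eq_catr _ [:: (_, _); (_, _)] [:: _; _]).
  by apply/skein_eq_sym/skein_eq_slide_cap; lia.
apply: (@skein_eq_trans _ [:: (Cross b, i); (Cup, i); (Cap, i.+1); (Cap, i)]).
  apply: (@skein_eq_catr _ [:: (_, _); (_, _)] [:: _; _]).
  have := @skein_eq_exchange n Cup (Cross b) i 0 isT isT.
  by rewrite /= !addn0 !addn2 => /(_ ltac:(lia)) /skein_eq_sym.
apply: (@skein_eq_cons _ n); first by run_tac.
apply: (@skein_eq_catr _ [:: (_, _); (_, _)] [::]).
by apply: skein_eq_zigzag_l; lia.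
Qed.

Lemma cup_curl n b i : (i <= n)%N ->
  skein_eq n [:: (Cup, i); (Cross b, i)] ((Cup, i) :: curl true (~~ b) i).
Proof.
move=> h; apply: skein_eq_sym.
apply: (@skein_eq_trans _ [:: (Cup, i); (Cup, i.+2); (Cross (~~ b), i.+1); (Cap, i)]).
  apply: (@skein_eq_catr _ [:: (_, _); (_, _)] [:: _; _]).
  have := @skein_eq_exchange n Cup Cup i 0 isT isT.
  by rewrite /= !addn0 !addn2 => /(_ ltac:(lia)).
apply: (@skein_eq_trans _ [:: (Cup, i); (Cup, i.+1); (Cross b, i.+2); (Cap, i)]).
  apply: (@skein_eq_cons _ n.+2); first by run_tac.
  apply: (@skein_eq_catr _ [:: (_, _); (_, _)] [:: _; _]).
  by apply/skein_eq_sym/skein_eq_slide_cup; lia.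
apply: (@skein_eq_cons _ n.+2); first by run_tac.
apply: (@skein_eq_trans _ [:: (Cup, i.+1); (Cap, i); (Cross b, i)]).
  apply: (@skein_eq_cons _ n.+4); first by run_tac.
  have := @skein_eq_exchange n.+4 Cap (Cross b) i 0 isT isT.
  by rewrite /= !addn0 !addn2 => /(_ ltac:(lia)).
apply: (@skein_eq_catr _ [:: (_, _); (_, _)] [::]).
by apply: skein_eq_zigzag_r; lia.
Qed.

(** The sign [b] is the one for which the end of the arc passes over its neighbour. In the order of
    the cases, the arc is lengthened at the left, shortened at the left, shortened at the right and
    lengthened at the right. *)
Lemma arc_cross n i j d : (j + d <= n)%N -> (i + 2 <= n.+2)%N ->
    [|| i.+1 == j, (i == j) && (0 < d), (i == j + d) && (0 < d)
      | i == (j + d).+1]%N ->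
  exists b j' d', (j' + d' <= n)%N /\
    skein_eq n (rcons (arc j d) (Cross b, i)) (arc j' d').
Proof.
move=> + + hcases.
case/or4P: hcases => [/eqP <-|/andP[/eqP -> hd]|/andP[/eqP -> hd]|/eqP ->] hjd hi.
- exists false, i, d.+1; split; first lia.
  apply: (@skein_eq_trans _ [:: (Cup, i.+1), (Cross false, i) & over i.+2 d]).
    apply: (@skein_eq_cons _ n.+2); first by run_tac.
    have := @over_comm_left n.+2 (Cross false) i i d isT.
    by rewrite /= !addn2; apply; lia.
  apply: (@skein_eq_catr _ [:: (_, _); (_, _)] [:: _; _]).
  by apply/skein_eq_sym/skein_eq_slide_cup; lia.
- case: d hd hjd => // d _ hjd; exists true, j.+1, d; split; first lia.
  apply: (@skein_eq_trans _
    [:: (Cup, j), (Cross true, j.+1), (Cross true, j) & over j.+2 d]).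
    apply: (@skein_eq_cons _ n.+2); first by run_tac.
    apply: (@skein_eq_cons _ n.+2); first by run_tac.
    have := @over_comm_left n.+2 (Cross true) j j d isT.
    by rewrite /= !addn2; apply; lia.
  apply: (@skein_eq_trans _
    [:: (Cup, j.+1), (Cross false, j), (Cross true, j) & over j.+2 d]).
    apply: (@skein_eq_catr _ [:: (_, _); (_, _)] [:: _; _]).
    by apply: skein_eq_slide_cup; lia.
  apply: (@skein_eq_cons _ n.+2); first by run_tac.
  apply: (@skein_eq_catr _ [:: (_, _); (_, _)] [::]).
  by apply: (skein_eq_move2 false); lia.
- case: d hd hjd hi => // d _ hjd hi; exists false, j, d; split; first lia.
  rewrite /arc overSr -!cats1 /= -catA addnS.
  apply: (@skein_eq_cons _ n.+2); first by run_tac.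
  rewrite -[in X in skein_eq _ _ X](cats0 (over _ _)).
  apply: (@skein_eq_catl _ n.+2); first by apply: run_over; lia.
  by apply: (skein_eq_move2 true); lia.
exists true, j, d.+1; split; first lia.
by rewrite /arc overSr addSn.
Qed.

Lemma good_top_over n p d t :
    (forall i b s, (i + 2 <= n)%N -> good_top n s -> good_top n ((Cross b, i) :: s)) ->
    (p + d < n)%N -> good_top n t -> good_top n (over p d ++ t).
Proof.
move=> H; elim: d p => // d IH p h ht; apply: H; first lia.
by apply: IH => //; lia.
Qed.

Lemma good_top_over_left n p d t :
    (forall i b s, (i + 2 <= n)%N -> good_top n s -> good_top n ((Cross b, i) :: s)) ->
    (p + d < n)%N -> good_top n t -> good_top n (over_left p d ++ t).
Proof.
move=> H; elim: d => // d IH h ht; rewrite over_leftS; apply: H; first lia.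
by apply: IH => //; lia.
Qed.

Lemma good_top_valid n k i t : ~~ is_vertex k -> (i + bot k <= n)%N ->
  good_top (n - bot k + top k) t ->
  vertexless ((k, i) :: t) /\ run n ((k, i) :: t) = Some 0.
Proof.
by move=> hk hi [ht rt _]; rewrite /= hi; split=> //; rewrite /vertexless /= negb_or hk.
Qed.

(** Pulled through the maximum, the arc becomes a zigzag and straightens out: what remains is the
    capped strand running to the left over the [d] others. *)
Lemma arc_cap_right n u j d t :
    (forall i b s, (i + 2 <= n)%N -> good_top n s -> good_top n ((Cross b, i) :: s)) ->
    layered n u -> (j + d < n)%N -> good_top n t ->
  P (u ++ rcons (arc j d) (Cap, (j + d).+1) ++ t).
Proof.
move=> H hu hjd ht; have [vt rt _] := ht.
have hr : run n (rcons (arc j d) (Cap, (j + d).+1)) = Some n.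
  rewrite -cats1 run_cat run_arc; last lia.
  by rewrite /= ifT ?subn2 ?addn0 //; lia.
apply: (@layered_skein_eq n u _ (over_left j d)) => //; last first.
- by have [_ _] := good_top_over_left H hjd ht; apply.
- by rewrite run_cat hr.
- by rewrite vertexless_cat vt /vertexless has_rcons /= andbT; apply: vertexless_over.
rewrite /arc /=.
apply: (@skein_eq_trans _ ((Cup, j) :: rcons (over_left j.+2 d) (Cap, j.+1))).
  apply: (@skein_eq_cons _ n.+2); first by run_tac.
  by apply: over_cap; lia.
rewrite -cats1 -cat_cons.
apply: (@skein_eq_trans _ (rcons (over_left j d) (Cup, j) ++ [:: (Cap, j.+1)])).
  by apply: skein_eq_catr; apply: cup_over_left.
rewrite cat_rcons -[in X in skein_eq _ _ X](cats0 (over_left j d)).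
apply: (@skein_eq_catl _ n).
  elim: d {hr} hjd => // d IH hjd; rewrite over_leftS /= ifT ?subnK; try lia.
  by apply: IH; lia.
by apply: skein_eq_zigzag_l; lia.
Qed.

Lemma layered_link n u t : layered n u -> vertexless t -> run n t = Some 0 ->
  link_word (u ++ t).
Proof.
move=> /layered_run[hu vu] vt rt.
by rewrite /link_word vertexless_cat vu vt run_cat hu /= rt.
Qed.

Lemma good_top_link n u t : layered n u -> good_top n t -> link_word (u ++ t).
Proof.
by move=> hu [vt rt _]; apply: layered_link rt.
Qed.

Lemma layered_curl n u left b i t : layered n u -> link_word (u ++ t) ->
  (i < n)%N -> P (u ++ t) -> P (u ++ curl left b i ++ t).
Proof.
move=> hu hut hi; have [ru vu] := layered_run hu.
apply: (skein_closed_curl hP) => //; move: hut.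
rewrite /link_word !vertexless_cat !run_cat ru /= run_cat.
rewrite (_ : run n (curl left b i) = Some n); first by case: (left).
by rewrite /curl; case: (left); run_tac.
Qed.

(** Strong induction on the number of strands, for caps and crossings together. A cap absorbs the
    top arc and leaves crossings on [n - 2] strands; a crossing of the wrong sign is switched, and
    its horizontal smoothing needs the case of a cap on the same [n] strands. *)
Lemma good_top_closed n :
  (forall i t, (i + 2 <= n)%N -> good_top (n - 2) t -> good_top n ((Cap, i) :: t)) /\
  (forall i b t, (i + 2 <= n)%N -> good_top n t -> good_top n ((Cross b, i) :: t)).
Proof.
elim/ltn_ind: n => n IH.
(* A letter away from both ends of the top arc moves below it, onto [m = n - 2] strands, and the arc
   is added to the good top. *)
have disjoint k i j d u m t : ~~ is_vertex k -> bot k = 2 ->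
    k = Cap \/ (exists b, k = Cross b) ->
    n = m.+2 -> layered m u -> (j + d <= m)%N -> (i + 2 <= n)%N ->
    [|| i + 1 < j, j + d + 1 < i | (j < i) && (i < j + d)]%N ->
    good_top (n - 2 + top k) t -> P ((u ++ arc j d) ++ (k, i) :: t).
  move=> vk bk hk en hu hjd hi hcases ht; have := hi; rewrite -bk => hi'.
  have ht' : good_top (n - bot k + top k) t by rewrite bk.
  have [vt rt] := good_top_valid vk hi' ht'; rewrite en in hi hi'.
  have [i' [j' [d' [h1 h2 h3]]]] := arc_disjoint vk bk hjd hi hcases.
  rewrite -catA -cat_rcons; apply: (layered_skein_eq hu h3).
  - by rewrite -cats1 -catA vertexless_cat vertexless_arc.
  - by rewrite -cats1 -catA run_cat run_arc //= -en.
  have hm : (m < n)%N by lia.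
  have hs : good_top (m - 2 + top k) (arc j' d' ++ t).
    apply: good_top_layered h2.
    by rewrite (_ : (m - 2 + top k).+2 = n - 2 + top k)%N //; lia.
  case: hk h1 vk bk hs => [->|[b ->]] h1 _ _ hs.
    by rewrite addn0 in hs; have [_ _] := (IH m hm).1 i' _ h1 hs; apply.
  rewrite subnK in hs; last lia.
  by have [_ _] := (IH m hm).2 i' b _ h1 hs; apply.
have capP i t : (i + 2 <= n)%N -> good_top (n - 2) t -> good_top n ((Cap, i) :: t).
  move=> hi ht; have := @good_top_valid n Cap i t isT hi; rewrite addn0.
  case/(_ ht) => vt rt; split=> // w.
  case/layered_inv=> [[n0 _]|[m [u [j [d [en -> hu hjd]]]]]]; first lia.
  have hm : (m < n)%N by lia.
  rewrite en !subSS subn0 in ht; have [_ cross] := IH m hm.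
  have [vt' rt' Ht] := ht.
  have [h|] := boolP [|| i + 1 < j, j + d + 1 < i | (j < i) && (i < j + d)]%N.
    by apply: (disjoint _ _ _ _ _ m) => //; [left|rewrite en !subSS subn0 addn0].
  move=> hcases.
  (* The cap joins an end of the arc to a neighbouring strand, or the two ends to each other when
     [i = j] and [d = 0]. *)
  have : [|| i.+1 == j, i == j, (i == j + d) && (0 < d) | i == (j + d).+1]%N by lia.
  case/or4P=> [/eqP ej|/eqP ei|/andP[/eqP ei hd]|/eqP ei]; rewrite -catA -cat_rcons.
  (* Left end and outer neighbour: a zigzag, which leaves that neighbour running over the [d]
     strands. *)
  - have hs : skein_eq m (rcons (arc j d) (Cap, i)) (over i d).
      rewrite -ej; apply: (@skein_eq_trans _ [:: (Cup, i.+1), (Cap, i) & over i d]).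
        apply: (@skein_eq_cons _ m.+2); first by run_tac.
        have := @over_comm_left m.+2 Cap i i d isT.
        by rewrite /= addn0 !addn2; apply; lia.
      apply: (@skein_eq_catr _ [:: (_, _); (_, _)] [::]).
      by apply: skein_eq_zigzag_r; lia.
    apply: (layered_skein_eq hu hs).
    + by rewrite -cats1 -catA vertexless_cat vertexless_arc.
    + by rewrite -cats1 -catA run_cat run_arc //= -en.
    by have [_ _] := @good_top_over m i d t cross ltac:(lia) ht; apply.
  (* Left end and right neighbour: a circle if [d = 0]; otherwise the neighbour is the first strand
     passed over, which acquires a kink and then runs over the others. *)
  - rewrite {}ei in hi vt rt hcases *; case: d hjd hcases => [|d] hjd hcases.
      apply: (skein_closed_circle hP) => //.
      + exact: good_top_link ht.
      + have [ru vu] := layered_run hu.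
        rewrite /link_word vertexless_cat vu -[vertexless (_ :: _)]/(vertexless t).
        rewrite vt' run_cat ru /= ifT; last lia.
        by rewrite ifT ?subn0 ?addnK ?addn0 ?rt' //; lia.
      exact: Ht.
    have hs : skein_eq m (rcons (arc j d.+1) (Cap, j)) (curl true true j ++ over j d).
      apply: (@skein_eq_cons _ m.+2); first by run_tac.
      apply: (@skein_eq_cons _ m.+2); first by run_tac.
      have := @over_comm_left m.+2 Cap j j d isT.
      by rewrite /= addn0 !addn2; apply; lia.
    apply: (layered_skein_eq hu hs).
    + by rewrite -cats1 -catA vertexless_cat vertexless_arc.
    + by rewrite -cats1 -catA run_cat run_arc //= -en.
    have hover : good_top m (over j d ++ t) by apply: good_top_over => //; lia.
    rewrite -catA; apply: (layered_curl _ _ hu) (good_top_link hu hover) _ _; first lia.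
    by have [_ _] := hover; apply.
  (* Right end and inner neighbour: the last crossing of the arc and the cap form a kink, and the
     shorter arc is then capped at its right end. *)
  - case: d hd hjd hcases ei => // d _ hjd hcases ei.
    have -> : rcons (arc j d.+1) (Cap, i) ++ t
        = arc j d ++ [:: (Cross true, i); (Cap, i)] ++ t.
      by rewrite /arc overSr addSn -addnS -ei -!cats1 /= -!catA.
    rewrite catA.
    have hu' : layered n (u ++ arc j d) by rewrite en; apply: Layered_arc => //; lia.
    apply: (layered_skein_eq hu' (curl_cap true hi)).
      exact: vt.
      by move: rt; rewrite /= hi subnK ?hi //; lia.
    rewrite -(catA (curl _ _ _)); apply: (layered_curl _ _ hu'); [|lia|].
      exact: layered_link rt.
    have := @arc_cap_right m u j d t cross hu ltac:(lia) ht.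
    by rewrite -cats1 -!catA ei addnS.
  by rewrite ei; apply: arc_cap_right cross hu _ ht; lia.
split=> // i b t hi ht.
have n2 : (n - 2 + 2 = n)%N by lia.
have [vt rt] := @good_top_valid n (Cross b) i t isT hi ltac:(by rewrite /= n2).
split=> // w /layered_inv[[n0 _]|[m [u [j [d [en -> hu hjd]]]]]]; first lia.
have hm : (m < n)%N by lia.
have [h|] := boolP [|| i + 1 < j, j + d + 1 < i | (j < i) && (i < j + d)]%N.
  apply: (disjoint _ _ _ _ _ m) => //; first by right; exists b.
  by rewrite /= n2.
move=> hcases.
have hu' : layered n (u ++ arc j d) by rewrite en; apply: Layered_arc => //; lia.
have [vt' rt' Ht] := ht.
(* If the crossing joins the two ends of a bare minimum, it is a kink, for either sign. *)
have [/andP[/eqP ei /eqP ed]|hcurl] := boolP ((i == j) && (d == 0%N)).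
  rewrite {}ei {}ed in hi vt rt hcases hu' hjd *.
  rewrite -catA; apply: (layered_skein_eq (x := [:: (Cup, j); (Cross b, j)])
    (y := (Cup, j) :: curl true (~~ b) j) hu) => //.
  - by apply: cup_curl; lia.
  - by rewrite -[_ ++ _]/(arc j 0 ++ (Cross b, j) :: t) run_cat run_arc //= -en.
  have := @layered_curl n _ true (~~ b) j t hu' (good_top_link hu' ht)
    ltac:(lia) (Ht _ hu').
  by rewrite -catA.
have hcases' : [|| i.+1 == j, (i == j) && (0 < d), (i == j + d) && (0 < d)
      | i == (j + d).+1]%N by lia.
have hi' : (i + 2 <= m.+2)%N by lia.
(* The crossing with sign [b0] is absorbed by the arc; if [b] is the other sign, the skein relation
   switches it. *)
have [b0 [j' [d' [h1 h2]]]] := arc_cross hjd hi' hcases'.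
have good : P ((u ++ arc j d) ++ (Cross b0, i) :: t).
  rewrite -catA -cat_rcons; apply: (layered_skein_eq hu h2).
  - by rewrite -cats1 -catA vertexless_cat vertexless_arc.
  - by rewrite -cats1 -catA run_cat run_arc //= -en -[RHS]rt.
  by rewrite catA; apply: Ht; rewrite en; apply: Layered_arc.
have [->//|bb0] := eqVneq b b0.
have eb : b0 = ~~ b by case: b b0 bb0 {vt rt h2 good} => [] [].
apply: (skein_closed_skein hP).
- exact: layered_link rt.
- by rewrite -eb.
- exact: Ht.
have hcup : good_top (n - 2) ((Cup, i) :: t).
  by apply: good_top_cup; [lia | rewrite en !subSS subn0 -en].
by have [_ _] := capP i _ hi hcup; apply.
Qed.

(** Every closing word is a good top, by adding its letters from the top downwards; the empty
    layered diagram below then gives the whole word. *)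
Lemma skein_induction w : link_word w -> P w.
Proof.
have good_top_word n t : vertexless t -> run n t = Some 0 -> good_top n t.
  elim: t n => [|[k i] t IH] n.
    move=> _ [->]; split=> // u /layered_inv[[_ ->]|[m [? [? [? []]]]]] //.
    exact: skein_closed_nil.
  rewrite /vertexless /= negb_or => /andP[vk vt]; case: ifP => // hi rt.
  have ht := IH _ vt rt; case: k hi vk rt ht => [||b|] //= hi _ rt ht.
  - by rewrite subn0 addn2 in ht; apply: good_top_cup => //; lia.
  - by apply: (good_top_closed n).1; rewrite addn0 in ht.
  by apply: (good_top_closed n).2 => //; rewrite subnK // in ht; lia.
by case/andP=> vw /eqP rw; have [_ _ /(_ _ Layered_nil)] := good_top_word 0 w vw rw.
Qed.

End SkeinInduction.

Local Open Scope ring_scope.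

(** * The Dubrovnik polynomial as a state sum *)

HB.instance Definition _ m n := GRing.isZmodMorphism.Build laurent laurent
  (mul_monomial m n) (lift_is_additive (fun e => monomial (e.1 + m) (e.2 + n))).

Section LaurentEval.

Variables (F : fieldType) (a z : F).
Notation ev := (laurent_eval a z).

(** Polynomials with different supports are compared over a common list of exponents. *)
Lemma laurent_eval_sub (s : seq (int * int)) f : uniq s -> {subset dom f <= s} ->
  ev f = \sum_(e <- s) (coeff e f)%:~R * (a ^ e.1 * z ^ e.2).
Proof.
move=> us hs; rewrite [RHS](bigID (mem (dom f))) /= [X in _ + X]big1 => [|e he].
  rewrite addr0 -big_filter; apply: perm_big; apply: uniq_perm.
  - exact: uniq_dom.
  - exact: filter_uniq.
  by move=> e; rewrite mem_filter andb_idr //; apply: hs.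
by rewrite coeff_outdom // mul0r.
Qed.

Lemma laurent_eval0 : ev 0 = 0.
Proof. by rewrite /laurent_eval dom0 big_nil. Qed.

Lemma laurent_evalB f g : ev (f - g) = ev f - ev g.
Proof.
pose s := undup (dom f ++ dom g).
have us : uniq s by exact: undup_uniq.
have sf : {subset dom f <= s} by move=> e he; rewrite mem_undup mem_cat he.
have sg : {subset dom g <= s} by move=> e he; rewrite mem_undup mem_cat he orbT.
have sfg : {subset dom (f - g) <= s} by move=> e /domB; rewrite mem_undup.
rewrite (laurent_eval_sub us sf) (laurent_eval_sub us sg) (laurent_eval_sub us sfg).
by rewrite -sumrB; apply: eq_bigr => e _; rewrite coeffB rmorphB mulrBl.
Qed.

Lemma laurent_evalD f g : ev (f + g) = ev f + ev g.
Proof.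
have -> : f + g = f - (0 - g) by rewrite sub0r opprK.
by rewrite !laurent_evalB laurent_eval0 sub0r opprK.
Qed.

Lemma laurent_eval_gen (c : int) e :
  ev << c *g e >> = c%:~R * (a ^ e.1 * z ^ e.2).
Proof.
have [->|c0] := eqVneq c 0; first by rewrite freegU0 laurent_eval0 mul0r.
by rewrite /laurent_eval domU // big_seq1 coeffU eqxx mulr1.
Qed.

Lemma laurent_eval_mul_monomial m n f : a != 0 -> z != 0 ->
  ev (mul_monomial m n f) = a ^ m * z ^ n * ev f.
Proof.
move=> a0 z0; rewrite -{1}(freeg_sumE f) raddf_sum /=.
rewrite (big_morph ev laurent_evalD laurent_eval0) [in RHS]/laurent_eval mulr_sumr.
apply: eq_bigr => e _; rewrite /mul_monomial liftU.
have -> : coeff e f *: monomial (e.1 + m) (e.2 + n)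
    = << coeff e f *g (e.1 + m, e.2 + n) >>.
  by apply/eqP/freeg_eqP => x; rewrite coeffZ !coeffU mul1r.
by rewrite laurent_eval_gen /= !expfzDr //; ring.
Qed.

End LaurentEval.

Section Linear.

Variables (fl vx : bool) (R : pzRingType) (g : int -> R).
Notation ts := (state_sum fl vx g).

(** A common lower part only selects labels, so a linear relation valid for all labels at one level
    survives below it. This reduces skein relations to local checks. *)
Lemma state_sum_linear (l : seq (R * word)) u n k :
    run n u = Some k ->
    (forall s e, size s = k -> \sum_(cx <- l) cx.1 * ts cx.2 s e = 0) ->
  forall s e, size s = n -> \sum_(cx <- l) cx.1 * ts (u ++ cx.2) s e = 0.
Proof.
elim: u n => [n [->] //|[t i] u IH n /=]; case: ifP => // hi hu H s e hs.
have [s1 [r [def_s hs1]]] := @split_at i s ltac:(lia).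
have [m [s2 [def_r hm]]] := @split_at (bot t) r
  ltac:(move: hi; rewrite -hs def_s size_cat; lia).
rewrite def_s def_r.
rewrite (eq_bigr (fun cx => \sum_(o <- local_states fl vx t m)
    cx.1 * ts (u ++ cx.2) (s1 ++ o.1 ++ s2) (e + o.2))); last first.
  by move=> cx _; rewrite state_sum_cons // mulr_sumr.
rewrite exchange_big /= big_seq big1 // => o /size_local_states[_ ho].
apply: IH hu H _ _ _; rewrite !size_cat ho -hs def_s def_r !size_cat; lia.
Qed.

End Linear.

Section Evaluation.

Variables (F : fieldType) (a : F).
Hypotheses (a0 : a != 0) (z0 : a - a^-1 != 0) (two0 : 2%:R != 0 :> F).
Variables (D : word -> laurent) (hD : dubrovnik D).

Notation ts := (state_sum true false (fun e => a ^ e)).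

(** The factor 2 is the number of orientations of the unknot, on which [D] is 1. *)
Definition defect (w : word) : F :=
  2%:R * laurent_eval a (a - a^-1) (D w) - ts w [::] 0.

Lemma state_sum_shift c w s e : ts w s (e + c) = a ^ c * ts w s e.
Proof.
elim: w s e => [|[k i] w IH] s e; first by rewrite /state_sum expfzDr // mulrC.
rewrite !state_sum_consE mulr_sumr; apply: eq_bigr => o _.
by rewrite [e + c + _]addrAC IH.
Qed.

Lemma defect_regular u x y v : regular_move x y ->
  link_diagram (u ++ x ++ v) -> link_diagram (u ++ y ++ v) ->
  defect (u ++ x ++ v) = defect (u ++ y ++ v).
Proof.
move=> hxy hx hy; have [/andP[gx _] /andP[gy _]] := (hx, hy).
rewrite /defect (dubrovnik_isotopy hD hx hy); last exact: rst_step.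
have [/andP[_ /eqP rx] /andP[_ /eqP ry]] := (gx, gy).
by rewrite (regular_state_sum _ _ _ _ hxy rx ry).
Qed.

Lemma defect_curl u v left b i :
  link_diagram (u ++ v) -> link_diagram (u ++ curl left b i ++ v) ->
  defect (u ++ curl left b i ++ v) = a ^ (if b then 1 else -1) * defect (u ++ v).
Proof.
move=> h h'; have /andP[/andP[_ /eqP r'] _] := h'.
rewrite /defect (dubrovnik_curl hD h h') laurent_eval_mul_monomial // expr0z mulr1.
by rewrite curl_state_sum // state_sum_shift; ring.
Qed.

Lemma defect_skein u v b i : link_diagram (u ++ (Cross b, i) :: v) ->
  defect (u ++ (Cross b, i) :: v) - defect (u ++ (Cross (~~ b), i) :: v)
  = (a - a^-1) * (defect (u ++ smoothing true b i ++ v)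
                 - defect (u ++ smoothing false b i ++ v)).
Proof.
move=> h; have := congr1 (laurent_eval a (a - a^-1)) (dubrovnik_skein hD h).
rewrite laurent_eval_mul_monomial // !laurent_evalB expr0z mul1r expr1z => E.
set z := a - a^-1 in E *.
(* The same relation for state sums, checked on the labels of the two strands. For equal labels only
   the vertical smoothing contributes; for opposite labels the horizontal one gives both orders of
   the labels, one of which cancels the vertical smoothing. *)
pose l := [:: (1, (Cross b, i) :: v); (-1, (Cross (~~ b), i) :: v);
  (- z, smoothing true b i ++ v); (z, smoothing false b i ++ v)].
have : \sum_(cx <- l) cx.1 * ts (u ++ cx.2) [::] 0 = 0.
  move: h => /andP[/andP[_ /eqP]]; rewrite run_cat.
  case hu: run => [n|] //= hrun _; apply: (state_sum_linear hu) => // s e hs.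
  move: hrun; rewrite -hs; case: ifP => // hi _.
  have [s1 [[|p [|q s2]] [def_s hs1]]] := @split_at i s ltac:(lia); last first.
  + rewrite {}def_s !big_cons big_nil /= /smoothing.
    case: b {E l} => /=; ts_simpl hs1;
    rewrite /crossing_sign ![ts _ _ (e + _)]state_sum_shift;
    case: p q => [] [] /=; rewrite ?(expr1z, exprN1) ?addr0 /z; ring.
  + by move: hi; rewrite def_s size_cat hs1 /=; lia.
  + by move: hi; rewrite def_s size_cat hs1 /=; lia.
rewrite /l !big_cons big_nil /= => E'.
have E1 : laurent_eval a z (D (u ++ (Cross b, i) :: v))
    = laurent_eval a z (D (u ++ (Cross (~~ b), i) :: v))
      + z * (laurent_eval a z (D (u ++ smoothing true b i ++ v))
             - laurent_eval a z (D (u ++ smoothing false b i ++ v))).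
  by rewrite -E addrC subrK.
have E2 : ts (u ++ (Cross b, i) :: v) [::] 0
    = ts (u ++ (Cross (~~ b), i) :: v) [::] 0
      + z * (ts (u ++ smoothing true b i ++ v) [::] 0
             - ts (u ++ smoothing false b i ++ v) [::] 0).
  by apply/eqP; rewrite -subr_eq0 -E'; apply/eqP; ring.
by rewrite /defect -/z {}E1 {}E2; ring.
Qed.

Lemma link_diagramE w : link_diagram w = (0 < size w)%N && link_word w.
Proof. by rewrite /link_diagram /graph_diagram /link_word /vertexless andbAC -andbA. Qed.

(** Apply the skein relation to a curl on the strand [i]: the two curls differ by [a - a^-1] times
    the plain diagram, one smoothing adds a circle and the other is a double zigzag. Dividing by
    [z = a - a^-1] gives the factor 2. *)
Lemma defect_circle u v i n : run 0 u = Some n -> (i < n)%N ->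
    link_diagram (u ++ [:: (Cup, i), (Cap, i) & v]) ->
  defect (u ++ [:: (Cup, i), (Cap, i) & v]) = 2%:R * defect (u ++ v).
Proof.
move=> ru hi hc.
have u0 : (0 < size u)%N by case: u ru {hc} => //= -[en]; rewrite -en in hi.
have [_ /andP[vc /eqP rc]] : (0 < size u)%N /\
    link_word (u ++ [:: (Cup, i), (Cap, i) & v]).
  by split=> //; move: hc; rewrite link_diagramE => /andP[].
have valid x : vertexless x -> run n x = Some n -> link_diagram (u ++ x ++ v).
  move=> vx rx; rewrite link_diagramE size_cat ltn_addr //=.
  move: vc rc; rewrite /link_word !vertexless_cat !run_cat ru /= run_cat rx /=.
  move=> /andP[-> vv]; rewrite vx /= ifT; last lia.
  by rewrite ifT; [rewrite subn0 addnK addn0 => ->; rewrite andbT | lia].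
have hcurl b : link_diagram (u ++ curl true b i ++ v) by apply: valid => //; run_tac.
have hid := valid [::] isT erefl.
have E b := defect_curl hid (hcurl b).
have hcr : link_diagram ((u ++ [:: (Cup, i)]) ++ (Cross true, i.+1) :: (Cap, i) :: v).
  by have := hcurl true; rewrite -!catA.
have := defect_skein hcr; rewrite /smoothing /= -!catA /=.
have -> : defect (u ++ [:: (Cup, i), (Cross true, i.+1), (Cap, i) & v])
  = a * defect (u ++ v) by have := E true.
have -> : defect (u ++ [:: (Cup, i), (Cross false, i.+1), (Cap, i) & v])
  = a^-1 * defect (u ++ v) by have := E false.
have -> : defect (u ++ [:: (Cup, i), (Cap, i.+1), (Cup, i.+1), (Cap, i) & v])
    = defect (u ++ v).
  rewrite -(@defect_regular u [:: (Cup, i.+1); (Cap, i)] [::] v) //.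
  - apply: (@defect_regular u [:: (Cup, i); (Cap, i.+1)] [::]
      ([:: (Cup, i.+1); (Cap, i)] ++ v)).
    + by apply: Or41; apply: PM_zigzag_l.
    + by apply: (valid [:: (Cup, i); (Cap, i.+1); (Cup, i.+1); (Cap, i)]) => //; run_tac.
    by apply: (valid [:: (Cup, i.+1); (Cap, i)]) => //; run_tac.
  - by apply: Or41; apply: PM_zigzag_r.
  by apply: (valid [:: (Cup, i.+1); (Cap, i)]) => //; run_tac.
rewrite -mulrBl => /(mulfI z0) /eqP; rewrite eq_sym subr_eq => /eqP ->.
by rewrite mulr2n mulrDl mul1r.
Qed.

Lemma run_addn k n w m : run n w = Some m -> run (n + k) w = Some (m + k)%N.
Proof.
elim: w n => [n [->] //|[t i] w IH n /=]; case: ifP => // hi /IH <-.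
rewrite ifT; last lia.
by congr run; lia.
Qed.

(* Enclosing w in a strand provides, at every height, a strand that can carry
   the curls by which the value of a circle is computed. *)
Definition wrap (w : word) : word := (Cup, 0%N) :: w ++ [:: (Cap, 0%N)].

Lemma link_wrap w : link_word w -> link_diagram (wrap w).
Proof.
move=> /andP[vw /eqP rw]; rewrite link_diagramE /= /link_word.
rewrite -[vertexless (wrap w)]/(vertexless (w ++ [:: (Cap, 0%N)])) vertexless_cat vw.
by rewrite /= run_cat (run_addn 2 rw).
Qed.

Lemma wrap_cat u x v : wrap (u ++ x ++ v)
  = ((Cup, 0%N) :: u) ++ x ++ (v ++ [:: (Cap, 0%N)]).
Proof. by rewrite /wrap /= -!catA. Qed.

Lemma laurent_eval_unknot : laurent_eval a (a - a^-1) (monomial 0 0) = 1.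
Proof. by rewrite laurent_eval_gen !expr0z !mulr1. Qed.

Lemma defect_wrap_closed : skein_closed (fun w => defect (wrap w) = 0).
Proof.
split.
- rewrite /defect (dubrovnik_unknot hD) laurent_eval_unknot mulr1 /wrap /=.
  rewrite (@ts_cup _ _ _ _ _ _ [::]) //= (@ts_cap _ _ _ _ _ _ [::]) //=.
  by rewrite (@ts_cap _ _ _ _ _ _ [::]) //= /state_sum subrr.
- move=> u x y v hxy /link_wrap hx /link_wrap hy.
  by rewrite !wrap_cat in hx hy *; rewrite (defect_regular hxy hx hy).
- move=> u v left b i /link_wrap huv /link_wrap hc.
  rewrite -(cat0s v) wrap_cat cat0s in huv; rewrite wrap_cat in hc.
  rewrite -{1}(cat0s v) !wrap_cat cat0s => H.
  by rewrite defect_curl // H mulr0.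
- move=> u v i huv /[dup] hw /link_wrap hc.
  rewrite -[in _ -> _](cat0s v) wrap_cat cat0s => H.
  have [/andP[_ /eqP rw] E] := (hw, wrap_cat u [:: (Cup, i); (Cap, i)] v).
  rewrite /= in E; rewrite E in hc *.
  move: rw; rewrite run_cat; case ru: run => [n|] //= ; case: ifP => // hi _.
  (* The two added strands make position [i] occupied even when [i = n]. *)
  rewrite -cat_cons (@defect_circle _ _ _ n.+2) ?H ?mulr0 //; last by lia.
  by have := run_addn 2 ru; rewrite !addn2.
move=> u v b i /link_wrap hc hneg hid hcc.
have E x := wrap_cat u x v.
have Ec b' := E [:: (Cross b', i)]; rewrite /= in Ec.
rewrite !Ec in hc hneg *.
have := @defect_skein ((Cup, 0%N) :: u) (v ++ [:: (Cap, 0%N)]) b i hc.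
rewrite !cat_cons hneg subr0 => ->.
have := E (smoothing true b i); have := E (smoothing false b i).
have hs isA : defect (wrap (u ++ smoothing isA b i ++ v)) = 0.
  by rewrite /smoothing; case: ifP.
by rewrite /= => <- <-; rewrite !hs subrr mulr0.
Qed.

(** The added strands run along the right side of the diagram; the maximum joining them slides down
    past one letter after another, until a split circle remains at the bottom. *)
Lemma defect_slide_cap u v m : run 0 u = Some m ->
    link_word (u ++ v) ->
  defect ((Cup, 0%N) :: u ++ (Cap, m) :: v) = defect [:: (Cup, 0%N), (Cap, 0%N) & u ++ v].
Proof.
elim/last_ind: u v m => [v m [<-] //|u [k i] IH v m].
rewrite -cats1 run_cat -!catA; case ru: run => [n|] //=; case: ifP => // hi [<-] huv.
have {IH} <- := IH _ n ru huv.
have [rc vc] : run 0 (u ++ (k, i) :: v) = Some 0%N /\ vertexless (u ++ (k, i) :: v).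
  by move: huv => /andP[-> /eqP].
have [vu vk vv] : [/\ vertexless u, ~~ is_vertex k & vertexless v].
  by move: vc; rewrite vertexless_cat /vertexless /= negb_or => /and3P[].
have rv : run (n - bot k + top k) v = Some 0%N by move: rc; rewrite run_cat ru /= hi.
have hm : planar_move [:: (Cap, n); (k, i)] [:: (k, i); (Cap, n - bot k + top k)%N].
  have := PM_exchange k Cap i (n - bot k - i).
  rewrite (_ : i + bot k + _ = n)%N; last lia.
  by rewrite (_ : i + top k + _ = n - bot k + top k)%N //; lia.
have hlink x : vertexless x -> run n.+2 x = Some (n - bot k + top k)%N ->
    link_diagram (((Cup, 0%N) :: u) ++ x ++ v).
  move=> vx rx; rewrite link_diagramE /= /link_word.
  rewrite -[vertexless _]/(vertexless (u ++ x ++ v)) !vertexless_cat vu vx vv.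
  rewrite /= run_cat; have := run_addn 2 ru; rewrite !addn2 => -> /=.
  by rewrite run_cat rx /= rv.
have := @defect_regular ((Cup, 0%N) :: u) _ _ v (Or41 _ _ _ hm).
rewrite /= => -> //.
  apply: (hlink [:: (Cap, n); (k, i)]); first by rewrite /vertexless /= orbF vk.
  by rewrite /= ifT ?addn2 ?subn2 ?addn0 //= hi.
apply: (hlink [:: (k, i); (Cap, _)]); first by rewrite /vertexless /= orbF vk.
rewrite /= ifT; last lia.
by rewrite ifT; [congr Some; lia | lia].
Qed.

(** The skein induction gives the vanishing for [wrap w], which is [w] with a split circle below it,
    and such a circle doubles the defect. *)
Lemma defect_link w : link_diagram w -> defect w = 0.
Proof.
move=> hw; have := hw; rewrite link_diagramE => /andP[w0 lw].
have := skein_induction defect_wrap_closed lw; rewrite /wrap.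
have := @defect_slide_cap w [::] 0%N; rewrite cats0 => ->.
- case: w w0 lw hw => // -[k i] w _ lw hw.
  (* Only this letter fits on zero strands. *)
  have [ek ei] : k = Cup /\ i = 0%N.
    by case/andP: lw => _; case: k {hw} => [||b|] /=; case: i => [|i] //=.
  rewrite {}ek {}ei in lw hw *.
  have [vw rw] : vertexless w /\ run 2 w = Some 0%N by case/andP: lw => vw /eqP.
  have valid x : vertexless x -> run 2 x = Some 4%N ->
      link_diagram ((Cup, 0%N) :: x ++ (Cap, 0%N) :: w).
    move=> vx rx; rewrite link_diagramE /= /link_word.
    rewrite -[vertexless _]/(vertexless (x ++ (Cap, 0%N) :: w)) vertexless_cat vx.
    by rewrite -[vertexless _]/(vertexless w) vw /= run_cat rx /= rw.
  (* Two exchanges lift the split circle above the first cup of [w], next to a strand, where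
     [defect_circle] applies. *)
  rewrite -(@defect_regular [:: (Cup, 0%N)] [:: (Cup, 2%N); (Cap, 0%N)]
    [:: (Cap, 0%N); (Cup, 0%N)] w); first last.
  + rewrite /vertexless in vw.
    by rewrite link_diagramE /= /link_word /vertexless /= vw rw.
  + by apply: (valid [:: (Cup, 2%N)]).
  + by apply: Or41; apply: (@PM_exchange Cap Cup 0 0).
  rewrite -(@defect_regular [::] [:: (Cup, 0%N); (Cup, 0%N)]
    [:: (Cup, 0%N); (Cup, 2%N)] ((Cap, 0%N) :: w)); first last.
  + by apply: (valid [:: (Cup, 2%N)]).
  + by apply: (valid [:: (Cup, 0%N)]).
  + by apply: Or41; apply: (@PM_exchange Cup Cup 0 0).
  have := @defect_circle [:: (Cup, 0%N)] w 0 2 erefl isT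
    (valid [:: (Cup, 0%N)] isT erefl).
  rewrite /= => ->.
  by move/eqP; rewrite mulf_eq0 (negbTE two0) => /eqP.
- by case/andP: lw => _ /eqP.
by [].
Qed.

Lemma laurent_eval_link w : link_diagram w ->
  2%:R * laurent_eval a (a - a^-1) (D w) = ts w [::] 0.
Proof. by move/defect_link/eqP; rewrite subr_eq0 => /eqP. Qed.

End Evaluation.

(** * Expansion of the vertices *)

Lemma big_tupleS (R : nmodType) (T : finType) n (f : seq T -> R) :
  \sum_(t : n.+1.-tuple T) f t = \sum_(x : T) \sum_(t : n.-tuple T) f (x :: t).
Proof.
rewrite pair_big /= (reindex (fun p : T * n.-tuple T => cons_tuple p.1 p.2)) //=.
exists (fun t => (thead t, behead_tuple t)) => [[x t] _|t _] /=.
  by congr pair; apply: val_inj.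
by rewrite [RHS]tuple_eta; apply: val_inj.
Qed.

Lemma run_resolve ch s w n : isSome (run n w) -> run n (resolve ch s w) = run n w.
Proof.
elim: w n ch s => [|[k i] w IH] n ch s //.
case: k => [||b|] /=; case: ifP => // hi hw; rewrite ?IH //.
have n2 : (n - 2 + 2 = n)%N by lia.
rewrite n2 in hw *; case: (head None s) => [isA|] /=.
  rewrite /smoothing; case: ifP => _ /=; first by rewrite IH.
  by rewrite hi !addn0 subn0 n2 ifT ?IH //; lia.
by rewrite hi n2 IH.
Qed.

Lemma vertexless_resolve ch s w : vertexless (resolve ch s w).
Proof.
elim: w ch s => [|[k i] w IH] ch s //; case: k => [||b|] /=; try exact: IH.
rewrite vertexless_cat IH andbT; case: (head None s) => [isA|] //=.
by rewrite /smoothing; case: ifP.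
Qed.

(** A smoothed vertex may leave no letter at all, but the first letter of [w] is a cup, so the
    resolved word is not empty. *)
Lemma link_resolve ch s w : graph_diagram w -> link_diagram (resolve ch s w).
Proof.
move=> /andP[w0 /eqP rw]; rewrite link_diagramE /link_word vertexless_resolve.
rewrite run_resolve rw //= andbT.
by case: w w0 rw => // -[[||b|] i] w _ //=; case: i.
Qed.

Section VertexExpansion.

Variables (F : fieldType) (a : F).
Hypotheses (a0 : a != 0).
Notation ts := (state_sum true false (fun e => a ^ e)).

Definition resolution_weight (r : seq (option bool)) : F :=
  (- a) ^+ count_mem (Some true) r * (- a^-1) ^+ count_mem (Some false) r.

Lemma resolution_weight_cons x r :
  resolution_weight (x :: r) = resolution_weight [:: x] * resolution_weight r.
Proof. by rewrite /resolution_weight /= !addn0 !exprD; ring. Qed.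

(** For equal labels the crossing cancels the vertical smoothing. For opposite labels it cancels one
    of the two states of the horizontal smoothing, and the rest is the alternating vertex with the
    factor [- a - a^-1]. *)
Lemma resolve_vertex_sum b i y s e : (i + 2 <= size s)%N ->
  \sum_(x : option bool)
     resolution_weight [:: x] * ts (resolve_vertex b x i ++ y) s e
  = (- a - a^-1) * ts ((Vertex, i) :: y) s e.
Proof.
move=> hi.
rewrite (bigD1 None) //= (bigD1 (Some true)) //= (bigD1 (Some false)) //=.
rewrite big1 ?addr0; last by case=> [[]|].
have [s1 [[|l [|r s2]] [def_s hs1]]] := @split_at i s ltac:(lia).
- by move: hi; rewrite def_s size_cat hs1 /=; lia.
- by move: hi; rewrite def_s size_cat hs1 /=; lia.
rewrite {}def_s /resolution_weight /= /smoothing.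
case: b => /=; ts_simpl hs1; rewrite /crossing_sign;
  case: l r => [] [] /=;
  rewrite ?(state_sum_shift a0) ?(expr1z, exprN1) ?expr1 ?expr0 ?addr0; ring.
Qed.

Lemma resolve_state_sum w n ch s e m : num_vertices w = n ->
    run (size s) w = Some m ->
  \sum_(r : n.-tuple (option bool)) resolution_weight r * ts (resolve ch r w) s e
  = (- a - a^-1) ^+ n * ts w s e.
Proof.
elim: w n ch s e => [|[k i] w IH] n ch s e.
  move=> <- _ /=; rewrite (big_pred1 [tuple]); last first.
    by move=> t; symmetry; apply/eqP; exact: tuple0.
  by rewrite /resolution_weight !mul1r.
have [-> {k}|hk] : k = Vertex \/ is_vertex k = false by case: (k); tauto.
  rewrite /num_vertices /= add1n => <-; case: ifP => // hi.
  rewrite subnK; last lia.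
  move=> hrun; rewrite (@big_tupleS _ _ (num_vertices w) (fun r =>
    resolution_weight r * ts (resolve_vertex (head true ch) (head None r) i
      ++ resolve (behead ch) (behead r) w) s e)).
  (* The lowest vertex is summed out while the replacements of the others are fixed. *)
  rewrite exchange_big /= (eq_bigr (fun r : (num_vertices w).-tuple _ => (- a - a^-1) *
    (resolution_weight r * ts ((Vertex, i) :: resolve (behead ch) r w) s e))).
    have [s1 [[|l [|q s2]] [def_s hs1]]] := @split_at i s ltac:(lia).
    - by move: hi; rewrite def_s size_cat hs1 /=; lia.
    - by move: hi; rewrite def_s size_cat hs1 /=; lia.
    rewrite -mulr_sumr exprS -mulrA.
    rewrite def_s; ts_simpl hs1; case: ifP => hq; last first.
      by rewrite mulr0 big1 // => r _; ts_simpl hs1; rewrite hq mulr0.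
    rewrite -(IH _ (behead ch) _ _ erefl) -?def_s //; congr (_ * _).
    by apply: eq_bigr => r _; rewrite def_s; ts_simpl hs1; rewrite hq.
  move=> r _.
  under eq_bigr => x _ do rewrite resolution_weight_cons mulrAC.
  by rewrite -mulr_suml resolve_vertex_sum // -mulrA; congr (_ * _); rewrite mulrC.
have -> : num_vertices ((k, i) :: w) = num_vertices w by rewrite /num_vertices /= hk.
move=> hn hrun.
have E r : ts (resolve ch r ((k, i) :: w)) s e
  = \sum_(o <- local_states true false k (window k i s))
      ts (resolve ch r w) (splice k i s o.1) (e + o.2).
  by case: k hk {hrun} => [||b|].
under eq_bigr => r _ do rewrite E mulr_sumr.
rewrite exchange_big /= state_sum_consE mulr_sumr [LHS]big_seq [RHS]big_seq.
apply: eq_bigr => o /size_local_states[_ ho]; move: hrun => /=; case: ifP => // hi.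
move=> hrun; apply: IH => //; rewrite -hrun; congr run.
by rewrite /splice !size_cat ho size_takel ?size_drop //; lia.
Qed.

Lemma kauffman_vogel_state_sum (D : word -> laurent) (G : word)
    (ch : (num_vertices G).-tuple bool) :
    dubrovnik D -> a - a^-1 != 0 -> 2%:R != 0 :> F -> graph_diagram G ->
  2%:R * kauffman_vogel a a^-1 a D ch
  = (- a - a^-1) ^+ num_vertices G * ts G [::] 0.
Proof.
move=> hD z0 two0 hG; have /andP[_ /eqP rG] := hG.
rewrite -(@resolve_state_sum G _ ch [::] 0 0%N erefl rG) mulr_sumr; apply: eq_bigr => r _.
rewrite mulrCA (laurent_eval_link a0 z0 two0 hD) //.
exact: link_resolve.
Qed.

End VertexExpansion.

(** * Existence of an orientation of the circuits *)

Section Orientable.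

Lemma state_sum_indep fl vx (V : nmodType) (c : V) w s e e' :
  state_sum fl vx (fun _ => c) w s e = state_sum fl vx (fun _ => c) w s e'.
Proof.
elim: w s e e' => [|[k i] w IH] s e e' //; rewrite !state_sum_consE.
by apply: eq_bigr => o _; apply: IH.
Qed.

Notation count := (state_sum true true (fun _ => 1 : int)).

Definition straighten (w : word) : word :=
  [seq if is_vertex l.1 then (Cross true, l.2) else l | l <- w].

Lemma count_straighten w s e : count (straighten w) s e = count w s e.
Proof.
elim: w s e => // -[k i] w IH s e; case: k => [||b|];
  rewrite /= !state_sum_consE; do ?by apply: eq_bigr => o _; apply: IH.
rewrite /local_states -[window Vertex i s]/(window (Cross true) i s).
case: window => [|l [|r [|x m]]]; rewrite ?big_nil //.
by rewrite /= !big_seq1 IH; apply: state_sum_indep.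
Qed.

Lemma link_straighten w n : run n (straighten w) = run n w /\ vertexless (straighten w).
Proof.
elim: w n => // -[k i] w IH n; have [h1 h2] := IH (n - bot k + top k)%N.
by case: k h1 => [||b|] /= ->.
Qed.

(** With constant weight, switching a crossing does not change the sum, curls do not affect it and a
    circle doubles it. *)
Lemma count_closed : skein_closed (fun w => count w [::] 0 != 0).
Proof.
have lin := @state_sum_linear true true int (fun _ => 1).
split.
- by [].
- move=> u x y v hxy /andP[_ /eqP hx] /andP[_ /eqP hy].
  by rewrite (regular_state_sum _ _ _ _ hxy hx hy).
- move=> u v left b i _ /andP[_ /eqP hc].
  by rewrite curl_state_sum // (state_sum_indep _ _ _ _ _ _ 0).
- move=> u v i _ /andP[_ /eqP]; rewrite run_cat; case ru: run => [n|] //= .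
  case: ifP => // hi _ h.
  have := lin [:: (1, [:: (Cup, i), (Cap, i) & v]); (-2%:R, v)] u 0%N n ru.
  move=> /(_ _ [::] 0 erefl) H; have {}H :
    count (u ++ [:: (Cup, i), (Cap, i) & v]) [::] 0 = 2%:R * count (u ++ v) [::] 0.
    apply/eqP; rewrite -subr_eq0 -[X in _ == X]H ?big_cons ?big_nil /=.
      by apply/eqP; ring.
    move=> s e hs; rewrite !big_cons big_nil /=.
    have [s1 [s2 [-> hs1]]] := @split_at i s ltac:(lia).
    by ts_simpl hs1; ring.
  by rewrite H mulf_eq0.
move=> u v b i /andP[_ /eqP]; rewrite run_cat; case ru: run => [n|] //=.
case: ifP => // hi _ h _ _.
have := lin [:: (1, (Cross b, i) :: v); (-1, (Cross (~~ b), i) :: v)] u 0%N n ru.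
move=> /(_ _ [::] 0 erefl) H; suff -> : count (u ++ (Cross b, i) :: v) [::] 0
  = count (u ++ (Cross (~~ b), i) :: v) [::] 0 by [].
apply/eqP; rewrite -subr_eq0 -[X in _ == X]H ?big_cons ?big_nil /=.
  by apply/eqP; ring.
move=> s e hs; rewrite !big_cons big_nil /=.
have [s1 [[|l [|r s2]] [def_s hs1]]] := @split_at i s ltac:(lia).
- by move: hi; rewrite -hs def_s size_cat hs1 /=; lia.
- by move: hi; rewrite -hs def_s size_cat hs1 /=; lia.
rewrite def_s; ts_simpl hs1; rewrite ![count _ _ (e + _)](state_sum_indep _ _ _ _ _ _ 0).
ring.
Qed.

Lemma count_neq0 w : run 0 w = Some 0%N -> count w [::] 0 != 0.
Proof.
move=> rw; rewrite -count_straighten; apply: (skein_induction count_closed).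
by have [h1 h2] := link_straighten w 0; rewrite /link_word h2 h1 rw.
Qed.

End Orientable.

Local Close Scope ring_scope.

(** * State sums as sums over labelings of the points *)

Section Histories.

Variable fl : bool.

Definition step (l : tile * nat) (s s' : seq bool) : bool :=
  s' \in [seq splice l.1 l.2 s o.1 | o <- local_states fl fl l.1 (window l.1 l.2 s)].

(** A history keeps the labels at every level. From here on [vx = fl]: the states are orientations
    of the circuits for [true] and colourings of the components for [false]. *)
Fixpoint histories (w : word) (s : seq bool) : seq (seq (seq bool)) :=
  if w is (k, i) :: w' then
    [seq s :: h | o <- local_states fl fl k (window k i s),
                  h <- histories w' (splice k i s o.1)]
  else [:: [:: s]].

Definition tile_sign (l : tile * nat) (s : seq bool) : int :=
  if l is (Cross b, i) then
    if fl then crossing_sign b (nth false s i) (nth false s i.+1) else 0%R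
  else 0%R.

Fixpoint total_sign (w : word) (h : seq (seq bool)) : int :=
  if w is l :: w' then (tile_sign l (head [::] h) + total_sign w' (behead h))%R
  else 0%R.

Lemma local_states_sign k i s o : o \in local_states fl fl k (window k i s) ->
  o.2 = tile_sign (k, i) s.
Proof.
rewrite /tile_sign; have E j : (j < bot k)%N ->
    nth false (window k i s) j = nth false s (i + j).
  by move=> hj; rewrite nth_take // nth_drop.
case: k E => [||b|] E.
- by case: window => [|? ?] //=; case: o => o1 o2; rewrite !inE => /orP[] /eqP[_ ->].
- case: window => [|l [|r [|x m]]] //=.
  by case: ifP => // _; rewrite inE => /eqP ->.
- move: (E 0%N isT) (E 1%N isT); rewrite addn0 addn1 => <- <-.
  by case: window => [|l [|r [|x m]]] //=; rewrite inE => /eqP ->.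
case: window => [|l [|r [|x m]]] //=.
by do ?case: ifP => _ //; rewrite inE => /eqP ->.
Qed.

Lemma histories_cons w s h : h \in histories w s -> h = s :: behead h.
Proof.
case: w => [|[k i] w] /=; first by rewrite inE => /eqP ->.
by move=> /allpairsPdep[o [h' [_ _ ->]]].
Qed.

Lemma state_sum_histories (V : nmodType) (g : int -> V) w s e :
  (state_sum fl fl g w s e = \sum_(h <- histories w s) g (e + total_sign w h))%R.
Proof.
elim: w s e => [|[k i] w IH] s e /=; first by rewrite big_seq1 addr0.
rewrite state_sum_consE big_allpairs_dep [LHS]big_seq [RHS]big_seq.
apply: eq_bigr => o ho; rewrite IH; apply: eq_bigr => h _ /=.
by rewrite addrA (local_states_sign ho).
Qed.

Lemma mem_histories w s h : reflect
  [/\ size h = (size w).+1, nth [::] h 0 = s &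
    forall t, (t < size w)%N ->
      step (nth (Cup, 0%N) w t) (nth [::] h t) (nth [::] h t.+1)]
  (h \in histories w s).
Proof.
elim: w s h => [|[k i] w IH] s h /=.
  rewrite inE; apply: (iffP eqP) => [->|[]]; first by split.
  by case: h => [|x [|y h]] //= _ ->.
apply: (iffP (@allpairsPdep _ _ _ _ _ _ _)) =>
  [[o [h' [ho /IH[sz h0 hs] ->]]]|[sz h0 hs]].
  split=> [||[|t] ht] //=; [by rewrite sz | | by apply: hs].
  by rewrite h0; apply/mapP; exists o.
case: h sz h0 hs => [|x h] //= [sz] -> hs.
have /mapP[o ho E] := hs 0%N isT.
exists o, h; split=> //; apply/IH; split=> // t ht; exact: (hs t.+1).
Qed.

Lemma splice_inj k i s m m' : (i <= size s)%N -> size m = size m' ->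
  splice k i s m = splice k i s m' -> m = m'.
Proof.
move=> hi hm /eqP; rewrite /splice eqseq_cat // eqxx /= eqseq_cat //.
by case/andP => /eqP.
Qed.

(** The row above a letter determines the local state there, its sign being a function of the row
    below. *)
Lemma uniq_histories w s m : run (size s) w = Some m -> uniq (histories w s).
Proof.
elim: w s => [|[k i] w IH] s //=; case: ifP => // hi hrun.
have hs o : o \in local_states fl fl k (window k i s) ->
    size (splice k i s o.1) = (size s - bot k + top k)%N.
  by move=> /size_local_states[_ ho]; rewrite !size_cat ho size_takel ?size_drop; lia.
apply: allpairs_uniq_dep.
- by case: (k) => [||b|]; case: window => [|l [|r [|x u]]] //=; do ?case: ifP.
- by move=> o ho; apply: IH; rewrite hs.
move=> [o h] [o' h'] /allpairsPdep[o1 [h1 [ho hh [-> ->]]]].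
move=> /allpairsPdep[o1' [h1' [ho' hh' [-> ->]]]] /= [E].
have Eo : o1 = o1'.
  have := histories_cons hh; have := histories_cons hh'; rewrite E => -> [E1].
  have [_ z] := size_local_states ho; have [_ z'] := size_local_states ho'.
  apply/eqP; rewrite /eq_op /= (splice_inj _ _ E1) ?z ?z' ?eqxx /=; [|lia|by []].
  by rewrite (local_states_sign ho) (local_states_sign ho').
by rewrite E -Eo.
Qed.

Lemma size_history w s h t m : run (size s) w = Some m -> h \in histories w s ->
  (t <= size w)%N -> Some (size (nth [::] h t)) = run (size s) (take t w).
Proof.
elim: w s h t => [|[k i] w IH] s h t /=.
  by rewrite inE => _ /eqP ->; case: t.
case: ifP => // hi hrun /allpairsPdep[o [h' [ho hh ->]]].
case: t => [|t] //= ht; rewrite hi.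
have hs : size (splice k i s o.1) = (size s - bot k + top k)%N.
  by have [_ h1] := size_local_states ho; rewrite !size_cat h1 size_takel ?size_drop; lia.
by rewrite -hs; apply: IH hh ht; rewrite hs.
Qed.

Lemma total_signE w h : (total_sign w h
  = \sum_(t < size w) tile_sign (nth (Cup, 0%N) w t) (nth [::] h t))%R.
Proof.
elim: w h => [|l w IH] h /=; first by rewrite big_ord0.
rewrite big_ord_recl /= nth0 IH; congr (_ + _)%R.
by apply: eq_bigr => t _; rewrite nth_behead.
Qed.

Lemma mkseqD (T : Type) (a : nat -> T) n m :
  mkseq a (n + m) = mkseq a n ++ mkseq (fun p => a (n + p)%N) m.
Proof.
rewrite /mkseq iotaD map_cat; congr (_ ++ _).
by rewrite -[(0 + n)%N]addn0 iotaDl -map_comp; apply: eq_map.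
Qed.

Lemma mkseq_eqP (T : eqType) (a a' : nat -> T) n :
  reflect (forall p, (p < n)%N -> a p = a' p) (mkseq a n == mkseq a' n).
Proof.
apply: (iffP eqP) => [E p hp|E].
  by have := congr1 (nth (a p) ^~ p) E; rewrite /= !nth_mkseq.
apply: (@eq_from_nth _ (a 0%N)); rewrite !size_mkseq // => p hp.
by rewrite !nth_mkseq ?E.
Qed.

(** The relation [step] position by position, for rows given as functions; rows of a labeling of the
    points have this form. *)
Definition tile_labels (k : tile) (i n : nat) (a a' : nat -> bool) : Prop :=
  [/\ forall p, (p < i)%N -> a' p = a p,
      forall p, (i + bot k <= p < n)%N -> a' (p - bot k + top k)%N = a p &
      match k with
      | Cup => a' i.+1 = a' i (+) fl
      | Cap => a i.+1 = a i (+) fl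
      | Cross _ => a' i.+1 = a i /\ a' i = a i.+1
      | Vertex => (a' i.+1 = a i /\ a' i = a i.+1) /\ (~~ fl -> a i.+1 = a i)
      end].

Lemma step_labels k i n a a' : (i + bot k <= n)%N ->
  reflect (tile_labels k i n a a')
    (step (k, i) (mkseq a n) (mkseq a' (n - bot k + top k))).
Proof.
move=> hi.
rewrite (_ : mkseq a n = mkseq a i ++ mkseq (fun p => a (i + p)%N) (bot k)
    ++ mkseq (fun p => a (i + (bot k + p))%N) (n - (i + bot k))); last first.
  by rewrite -mkseqD -[mkseq _ _ ++ _]mkseqD; congr mkseq; lia.
rewrite (_ : mkseq a' _ = mkseq a' i ++ mkseq (fun p => a' (i + p)%N) (top k)
    ++ mkseq (fun p => a' (i + (top k + p))%N) (n - (i + bot k))); last first.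
  by rewrite -mkseqD -[mkseq _ _ ++ _]mkseqD; congr mkseq; lia.
set A := mkseq a i; set m := mkseq _ (bot k); set B := mkseq _ (n - _).
set A' := mkseq a' i; set m' := mkseq _ (top k); set B' := mkseq _ (n - _).
have -> : step (k, i) (A ++ m ++ B) (A' ++ m' ++ B')
  = [&& A' == A, B' == B & m' \in [seq o.1 | o <- local_states fl fl k m]].
  rewrite /step /= window_cat ?size_mkseq //; apply/idP/and3P.
    case/mapP=> o ho /eqP; rewrite splice_cat ?size_mkseq //.
    have [_ zo] := size_local_states ho.
    rewrite eqseq_cat ?size_mkseq // eqseq_cat ?size_mkseq // => /and3P[-> /eqP -> ->].
    by split=> //; apply/mapP; exists o.
  case=> /eqP -> /eqP -> /mapP[o ho ->]; apply/mapP; exists o => //.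
  by rewrite splice_cat ?size_mkseq.
have hB : reflect
    (forall p, (i + bot k <= p < n)%N -> a' (p - bot k + top k)%N = a p) (B' == B).
  apply: (iffP (mkseq_eqP _ _ _)) => H p hp.
    have := H (p - (i + bot k))%N ltac:(lia).
    have -> : (i + (bot k + (p - (i + bot k))) = p)%N by lia.
    by have -> : (i + (top k + (p - (i + bot k))) = p - bot k + top k)%N by lia.
  have := H (i + (bot k + p))%N ltac:(lia).
  by have -> : (i + (bot k + p) - bot k + top k = i + (top k + p))%N by lia.
have hm : reflect match k with
      | Cup => a' i.+1 = a' i (+) fl
      | Cap => a i.+1 = a i (+) fl
      | Cross _ => a' i.+1 = a i /\ a' i = a i.+1
      | Vertex => (a' i.+1 = a i /\ a' i = a i.+1) /\ (~~ fl -> a i.+1 = a i)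
      end (m' \in [seq o.1 | o <- local_states fl fl k m]).
  rewrite /m /m'; case: (k) => [||b|]; rewrite /mkseq /= ?addn0 ?addn1.
  - rewrite !inE !eqseq_cons; apply: (iffP idP);
      by case: (a' i); case: (a' i.+1); case: (fl).
  - by case: eqP => h; constructor.
  - by rewrite inE; apply: (iffP eqP) => [[-> ->]|[-> ->]].
  case: (fl) => /=; first by rewrite inE; apply: (iffP eqP) => [[-> ->]|[[-> ->]]].
  rewrite addbF; case: eqP => h /=; last by constructor; case=> _ /(_ isT).
  by rewrite inE; apply: (iffP eqP) => [[-> ->]|[[-> ->] _]]; rewrite h.
apply: (iffP and3P) => [[/mkseq_eqP h1 /hB h2 /hm h3]|[h1 h2 h3]]; first by split.
by split; [apply/mkseq_eqP | apply/hB | apply/hm].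
Qed.

End Histories.

Section Labelings.

Variables (w : word) (rw : run 0 w = Some 0).

Definition width (t : nat) : nat := odflt 0 (run 0 (take t w)).

Lemma run_width t : run 0 (take t w) = Some (width t).
Proof.
have := rw; rewrite -{1}(cat_take_drop t w) run_cat /width.
by case: run.
Qed.

Lemma letter_at t : (t < size w)%N ->
  let l := nth (Cup, 0%N) w t in
  [/\ onth w t = Some l, (l.2 + bot l.1 <= width t)%N &
      width t.+1 = (width t - bot l.1 + top l.1)%N].
Proof.
move=> ht l; split.
- by rewrite onthE (nth_map (Cup, 0%N)).
- have := run_width t.+1; rewrite (take_nth (Cup, 0%N)) // -cats1 run_cat run_width /=.
  by rewrite -/l; case: l => k i; case: ifP.
have := run_width t.+1; rewrite (take_nth (Cup, 0%N)) // -cats1 run_cat run_width /=.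
by rewrite -/l; case: l => k i; case: ifP => //= _ [].
Qed.

(** This bound guarantees that [inord] in [pt] does not fall back to its default on actual
    points. *)
Lemma width_le t : (width t <= (size w).*2)%N.
Proof.
have H u n m : run n u = Some m -> (m <= n + (size u).*2)%N.
  elim: u n => [n [->]|[k i] u IH n /=]; first lia.
  case: ifP => // hi /IH; case: k hi => [||b|] /=; lia.
by have := H _ _ _ (run_width t); rewrite size_take_min; lia.
Qed.

Lemma pt_1 t p : (t <= size w)%N -> (pt w t p).1 = t :> nat.
Proof. by move=> ht; rewrite /= inordK. Qed.

Lemma pt_2 t p : (p <= (size w).*2)%N -> (pt w t p).2 = p :> nat.
Proof. by move=> ht; rewrite /= inordK. Qed.

Lemma pt_eta (x : point w) : pt w x.1 x.2 = x.
Proof. by case: x => t p; rewrite /pt /= !inord_val. Qed.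

Lemma is_pointE (x : point w) : is_point x = (x.2 < width x.1)%N.
Proof. by []. Qed.

Lemma is_point_pt t p : (t <= size w)%N -> (p < width t)%N -> is_point (pt w t p).
Proof.
move=> ht hp; rewrite is_pointE pt_1 // pt_2 //.
by have := width_le t; lia.
Qed.

Definition rows (f : {ffun point w -> bool}) : seq (seq bool) :=
  mkseq (fun t => mkseq (fun p => f (pt w t p)) (width t)) (size w).+1.

Lemma nth_rows f t p : (t <= size w)%N -> (p < width t)%N ->
  nth false (nth [::] (rows f) t) p = f (pt w t p).
Proof. by move=> ht hp; rewrite !nth_mkseq. Qed.

Variable fl : bool.

(** Prescribing [false] on pairs that are not points makes a labeling determined by its rows, hence
    by its history. *)
Definition labelings : {set {ffun point w -> bool}} :=
  [set f : {ffun point w -> bool} | [forall x, f x ==> is_point x]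
     && (rows f \in histories fl w [::])].

Lemma labelings_sum (V : nmodType) (G : seq (seq bool) -> V) :
  (\sum_(h <- histories fl w [::]) G h = \sum_(f in labelings) G (rows f))%R.
Proof.
rewrite -big_enum -(big_map rows xpredT G); apply: perm_big; apply: uniq_perm.
- exact: (@uniq_histories fl w [::] 0 rw).
- rewrite map_inj_in_uniq ?enum_uniq // => f f'.
  rewrite !mem_enum !inE => /andP[/forallP hf _] /andP[/forallP hf' _] E.
  apply/ffunP => x; have [hx|hx] := boolP (is_point x).
    have := congr1 (fun h => nth false (nth [::] h x.1) x.2) E.
    by rewrite /= !nth_rows // ?pt_eta // -ltnS.
  by have := hf x; have := hf' x; rewrite (negbTE hx) !implybF => /negbTE -> /negbTE ->.
move=> h; apply/idP/mapP => [hh|[f]]; last first.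
  by rewrite mem_enum inE => /andP[_ hf] ->.
(* The inverse of [rows]; outside the rows the default of [nth] supplies the value [false]. *)
pose f : {ffun point w -> bool} :=
    [ffun x : point w => nth false (nth [::] h x.1) x.2].
have hsz t : (t <= size w)%N -> size (nth [::] h t) = width t.
  by move=> ht; have := @size_history fl w [::] h t 0 rw hh ht; rewrite run_width => -[].
have Eh : rows f = h.
  have [sz _ _] := elimT (mem_histories _ _ _ _) hh.
  apply: (@eq_from_nth _ [::]); rewrite size_mkseq // => t ht.
  apply: (@eq_from_nth _ false); first by rewrite hsz // nth_mkseq // size_mkseq.
  move=> p; rewrite nth_mkseq // size_mkseq => hp.
  rewrite nth_mkseq // ffunE pt_1 // pt_2 //.
  by have := width_le t; lia.
exists f => //; rewrite mem_enum inE Eh hh andbT; apply/forallP => x.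
rewrite ffunE; apply/implyP; rewrite is_pointE; apply: contraTT; rewrite -leqNgt => hx.
by rewrite nth_default // hsz // -ltnS.
Qed.

Lemma labelingsP (f : {ffun point w -> bool}) : reflect
  [/\ forall x, f x -> is_point x &
    forall t, (t < size w)%N ->
      tile_labels fl (nth (Cup, 0%N) w t).1 (nth (Cup, 0%N) w t).2 (width t)
        (fun p => f (pt w t p)) (fun p => f (pt w t.+1 p))]
  (f \in labelings).
Proof.
have E t : (t < size w)%N ->
  step fl (nth (Cup, 0%N) w t) (nth [::] (rows f) t) (nth [::] (rows f) t.+1)
  = step fl (nth (Cup, 0%N) w t) (mkseq (fun p => f (pt w t p)) (width t))
      (mkseq (fun p => f (pt w t.+1 p))
        (width t - bot (nth (Cup, 0%N) w t).1 + top (nth (Cup, 0%N) w t).1)).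
  move=> ht; rewrite !nth_mkseq //; last by lia.
  by have [_ _ ->] := letter_at ht.
rewrite inE; apply: (iffP andP) => [[/forallP h1 /mem_histories[_ _ h2]]|[h1 h2]].
  split=> [x|t ht]; first exact/implyP.
  have := h2 t ht; rewrite E //; have [_ hi _] := letter_at ht.
  by case: nth hi => k i /= hi /step_labels; apply.
split; first by apply/forallP => x; apply/implyP/h1.
apply/mem_histories; split; first by rewrite size_mkseq.
  by rewrite nth_mkseq // /width take0.
move=> t ht; rewrite E //; have [_ hi _] := letter_at ht; have := h2 t ht.
by case: nth hi => k i /= hi /step_labels; apply.
Qed.

Lemma risesE (x y : point w) : rises x y ->
  let l := nth (Cup, 0%N) w x.1 in
  [/\ (x.1 < size w)%N, y.1 = x.1.+1 :> nat &
   [\/ (x.2 < l.2)%N /\ y.2 = x.2 :> nat,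
       (l.2 + bot l.1 <= x.2)%N /\ y.2 = (x.2 - bot l.1 + top l.1)%N :> nat,
       [/\ is_cross l.1 || is_vertex l.1, x.2 = l.2 :> nat & y.2 = l.2.+1 :> nat] |
       [/\ is_cross l.1 || is_vertex l.1, x.2 = l.2.+1 :> nat & y.2 = l.2 :> nat]]].
Proof.
move=> /andP[/eqP ->]; have [ht|ht] := ltnP x.1 (size w); last by rewrite onth_default.
have [-> _ _] := letter_at ht; case: nth => k i /= hxy; split=> //; move: hxy.
case/or3P => [/andP[h1 /eqP h2]|/andP[h1 /eqP h2]|/andP[h0 /orP[]/andP[/eqP h1 /eqP h2]]].
- by constructor 1.
- by constructor 2.
- by constructor 3.
by constructor 4.
Qed.

Lemma turnsE (x y : point w) : turns x y ->
  [/\ y.1 = x.1, y.2 = x.2.+1 :> nat &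
   (exists i, [/\ (x.1 < size w)%N, nth (Cup, 0%N) w x.1 = (Cap, i) & x.2 = i :> nat]) \/
   (exists t i, [/\ (t < size w)%N, x.1 = t.+1 :> nat,
      nth (Cup, 0%N) w t = (Cup, i) & x.2 = i :> nat])].
Proof.
case/and3P => /eqP h1 /eqP h2 h; split=> //; case/orP: h => [h|/andP[x0 h]]; [left|right].
  move: h; case E: onth => [[[||b|] i]|] //= /eqP hx; exists i; split=> //.
    by rewrite -onthTE E.
  by apply: onth_nth.
move: h; case E: onth => [[[||b|] i]|] //= /eqP hx; exists x.1.-1, i; split=> //.
- by rewrite -onthTE E.
- by rewrite prednK.
by apply: onth_nth.
Qed.

Lemma meetsE (x y : point w) : meets x y ->
  [/\ y.1 = x.1, y.2 = x.2.+1 :> nat, (x.1 < size w)%N &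
    nth (Cup, 0%N) w x.1 = (Vertex, nat_of_ord x.2)].
Proof.
case/and3P => /eqP h1 /eqP h2; case E: onth => [[[||b|] i]|] //= /eqP hx; split=> //.
  by rewrite -onthTE E.
by rewrite hx; apply: onth_nth.
Qed.

Lemma rises_point (x y : point w) : rises x y -> is_point x = is_point y.
Proof.
move/risesE => /=; rewrite !is_pointE; case=> ht -> h.
have [_ hi ->] := letter_at ht; move: h hi; case: nth => k i /=.
case: k => [||b|] /= h hi; apply/idP/idP => hp;
  by case: h => [[? ?]|[? ?]|[? ? ?]|[? ? ?]] //; lia.
Qed.

Lemma turns_point (x y : point w) : turns x y -> is_point x /\ is_point y.
Proof.
case/turnsE => h1 h2 h; rewrite !is_pointE h1 h2.
case: h => [[i [ht E hi]]|[t [i [ht E1 E hi]]]].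
  by have [_] := letter_at ht; rewrite E hi /=; split; lia.
by have [_] := letter_at ht; rewrite E1 E hi /=; split; lia.
Qed.

Lemma meets_point (x y : point w) : meets x y -> is_point x /\ is_point y.
Proof.
case/meetsE => h1 h2 ht E; rewrite !is_pointE h1 h2.
by have [_] := letter_at ht; rewrite E /=; split; lia.
Qed.

(** The letterwise conditions are recast through the adjacency relations that define circuits and
    components. *)
Definition respects (f : {ffun point w -> bool}) : Prop :=
  [/\ forall x, f x -> is_point x,
      forall x y, rises x y -> f x = f y,
      forall x y, turns x y -> f y = f x (+) fl &
      ~~ fl -> forall x y, meets x y -> f x = f y].

Lemma labelings_respects f : f \in labelings -> respects f.
Proof.
case/labelingsP => hpt H.
have eta (x : point w) (t p : nat) :
    x.1 = t :> nat -> x.2 = p :> nat -> f x = f (pt w t p).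
  by move=> <- <-; rewrite pt_eta.
split=> // [x y hxy|x y|nfl x y].
- have := rises_point hxy; case/risesE: hxy => ht Ey h hxy.
  have [hx|hx] := boolP (is_point x); last first.
    have /negbTE -> : ~~ f x by apply: contra hx; exact: hpt.
    have /negbTE -> // : ~~ f y by rewrite hxy in hx; apply: contra hx; exact: hpt.
  move: hx; rewrite is_pointE (eta x x.1 x.2) // => hx.
  case: (H _ ht) => h1 h2; case: nth h h1 h2 => k i /= h h1 h2 h3.
  case: h => [[hp E2]|[hp E2]|[hk E1 E2]|[hk E1 E2]].
  + by rewrite (eta y x.1.+1 x.2) // h1.
  + by rewrite (eta y x.1.+1 _ Ey E2) h2 // hp.
  + rewrite (eta y x.1.+1 _ Ey E2) E1.
    by case: k hk h3 {h1 h2} => [||b|] //= _; [case=> -> | case=> -[->]].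
  rewrite (eta y x.1.+1 _ Ey E2) E1.
  by case: k hk h3 {h1 h2} => [||b|] //= _; [case=> _ -> | case=> -[_ ->]].
- case/turnsE => E1 E2 [[i [ht E hi]]|[t [i [ht E3 E hi]]]];
    have [_ _] := H _ ht; rewrite E /=.
    by rewrite (eta y x.1 x.2.+1) ?E1 // (eta x x.1 x.2) // hi.
  by rewrite (eta y t.+1 x.2.+1) ?E1 // (eta x t.+1 x.2) // hi.
case/meetsE => E1 E2 ht E; have [_ _] := H _ ht; rewrite E /= => -[_ /(_ nfl)].
by rewrite (eta y x.1 x.2.+1) ?E1 // (eta x x.1 x.2).
Qed.

Lemma respects_labelings f : respects f -> f \in labelings.
Proof.
case=> hpt hr ht hm; apply/labelingsP; split=> // t lt_t.
have [El hi Ew] := letter_at lt_t; have wt := width_le t; have wt' := width_le t.+1.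
case E: (nth _ w t) El hi Ew => [k i] /= El hi Ew.
have rise p q : (p < width t)%N -> (q < width t.+1)%N ->
    [|| (p < i) && (q == p), (i + bot k <= p) && (q == p - bot k + top k)
      | (is_cross k || is_vertex k) &&
        ((p == i) && (q == i.+1) || (p == i.+1) && (q == i))]%N ->
    f (pt w t.+1 q) = f (pt w t p).
  move=> hp hq h; apply/esym/hr; rewrite /rises !pt_1 ?eqxx //=; [|lia..].
  by rewrite El !pt_2 //; lia.
split=> [p hp|p hp|].
- by apply: rise; case: (k) hi Ew => [||b|] /=; lia.
- by apply: rise; case: (k) hi Ew hp => [||b|] /=; lia.
case: k E El hi Ew rise => [||b|] E El hi Ew rise; rewrite /= in hi Ew.
- apply: ht; rewrite /turns /= eqxx !inordK ?eqxx /=; [|lia..].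
  by rewrite El eqxx orbT.
- apply: ht; rewrite /turns /= eqxx !inordK ?eqxx /=; [|lia..].
  by rewrite El eqxx.
- by split; apply: rise; rewrite /=; lia.
split; first by split; apply: rise; rewrite /=; lia.
move=> nfl; apply/esym/hm => //; rewrite /meets /= eqxx !inordK ?eqxx /=; [|lia..].
by rewrite El eqxx.
Qed.

End Labelings.

(** * Components and twisting number *)

Lemma connect_ind_eq (T : finType) (S : eqType) (e : rel T) (f : T -> S) x y :
  (forall x y, e x y -> f x = f y) -> connect e x y -> f x = f y.
Proof.
move=> he /connectP[p]; elim: p x => [|z p IH] x /=; first by move=> _ ->.
by case/andP => /he -> /IH.
Qed.

(** Such a function amounts to the set of roots, among those satisfying [a], on which it is true. *)
Lemma card_locally_constant (T : finType) (e : rel T) (a : pred T) :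
    symmetric e -> (forall x y, e x y -> a x = a y) ->
  #|[set f : {ffun T -> bool} | [forall x, f x ==> a x] &&
      [forall x, forall y, e x y ==> (f x == f y)]]| = 2 ^ n_comp e a.
Proof.
move=> se ca; have sc : connect_sym e := sym_connect_sym se.
have aroot x : a (fingraph.root e x) = a x.
  by apply/esym/(connect_ind_eq ca)/connect_root.
pose R := [set x | roots e x && a x].
have -> : n_comp e a = #|R| by apply: eq_card => x; rewrite !inE.
rewrite -card_powerset.
pose F (S : {set T}) : {ffun T -> bool} := [ffun x => fingraph.root e x \in S].
rewrite -(@card_in_imset _ _ F) => [|S S'].
  apply: eq_card => f; rewrite inE; apply/andP/imsetP => [[/forallP fa /forallP fe]|[S]].
    have fe' x y : e x y -> f x = f y.
      by move=> exy; have /forallP/(_ y) := fe x; rewrite exy => /eqP.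
    have froot x : f (fingraph.root e x) = f x.
      by apply/esym/(connect_ind_eq fe')/connect_root.
    exists [set x in R | f x].
      by rewrite inE; apply/subsetP => x; rewrite inE => /andP[].
    apply/ffunP => x; rewrite ffunE !inE froot roots_root // aroot /=.
    by case: (f x) (fa x) => //=; rewrite ?andbF // => ->.
  rewrite inE => /subsetP hS ->; split; apply/forallP => x.
    rewrite ffunE; apply/implyP => /hS; rewrite inE => /andP[_].
    by rewrite aroot.
  apply/forallP => y; apply/implyP => exy; rewrite !ffunE.
  by rewrite (fingraph.rootP sc (connect1 exy)).
rewrite !inE => /subsetP hS /subsetP hS' /ffunP E; apply/setP => x.
have [hx|hx] := boolP (x \in R).
  have rx : fingraph.root e x = x by move: hx; rewrite inE => /andP[/eqP].
  by have := E x; rewrite !ffunE rx.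
by rewrite (contraNF (hS x) hx) (contraNF (hS' x) hx).
Qed.

Section Invariants.

Variables (w : word) (rw : run 0 w = Some 0).

Lemma circuit_adj_sym : symmetric (@circuit_adj w).
Proof.
by move=> x y; rewrite /circuit_adj; do ?case: rises; do ?case: turns.
Qed.

Lemma graph_adj_sym : symmetric (@graph_adj w).
Proof.
move=> x y; rewrite /graph_adj circuit_adj_sym.
by do ?case: meets; rewrite ?orbT.
Qed.

Lemma circuit_adj_point x y : @circuit_adj w x y -> is_point x = is_point y.
Proof.
case/or4P => [/(rises_point rw)|/(rises_point rw)|/(turns_point rw)[-> ->]|
  /(turns_point rw)[-> ->]] //.
Qed.

Lemma graph_adj_point x y : @graph_adj w x y -> is_point x = is_point y.
Proof.
by case/or3P => [/circuit_adj_point|/(meets_point rw)[-> ->]|/(meets_point rw)[-> ->]].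
Qed.

Lemma card_labelings_components : #|labelings w false| = 2 ^ num_components w.
Proof.
rewrite /num_components -(card_locally_constant graph_adj_sym graph_adj_point).
apply: eq_card => f; rewrite [in RHS]inE; apply/idP/andP.
  case/(labelings_respects rw) => h1 h2 h3 /(_ isT) h4; split.
    by apply/forallP => x; apply/implyP/h1.
  apply/forallP => x; apply/forallP => y; apply/implyP.
  have h3' u v : turns u v -> f u = f v by move/h3; rewrite addbF.
  by case/or3P => [/or4P[]|/h4|/h4] => [/h2|/h2|/h3'|/h3'||] ->.
case=> /forallP h1 /forallP h2; apply: (respects_labelings rw).
have h x y : @graph_adj w x y -> f x = f y.
  by move=> hxy; have /forallP/(_ y) := h2 x; rewrite hxy => /eqP.
split=> [x|x y hxy|x y hxy|_ x y hxy]; first exact/implyP.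
- by apply: h; rewrite /graph_adj /circuit_adj hxy.
- by rewrite addbF; apply/esym/h; rewrite /graph_adj /circuit_adj hxy !orbT.
by apply: h; rewrite /graph_adj hxy !orbT.
Qed.

Lemma oriented_label f x d y d' : f \in labelings w true ->
  connect (@oriented_adj w) (x, d) (y, d') -> f y (+) d' = f x (+) d.
Proof.
case/(labelings_respects rw) => _ h2 h3 _ hc.
apply/esym/(@connect_ind_eq _ _ _ (fun X : point w * bool => f X.1 (+) X.2) _ _ _ hc).
move=> [u e] [v e'] /=; case/orP => /= /andP[/orP[h|h] /eqP ->].
- by rewrite (h2 _ _ h).
- by rewrite (h2 _ _ h).
- by rewrite (h3 _ _ h); case: (f u); case: e.
by rewrite (h3 _ _ h); case: (f v); case: e.
Qed.

Lemma connect_oriented x y d : connect (@circuit_adj w) x y ->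
  exists d', connect (@oriented_adj w) (x, d) (y, d').
Proof.
case/connectP => p; elim: p x d => [|z p IH] x d /=; first by move=> _ ->; exists d.
case/andP => hxz hp Ey.
have [d1 hd1] : exists d1, @oriented_adj w (x, d) (z, d1).
  case/or4P: hxz => h; [exists d | exists d | exists (~~ d) | exists (~~ d)];
    by rewrite /oriented_adj /= h eqxx ?orbT.
have [d' hd'] := IH z d1 hp Ey; exists d'.
exact: connect_trans (connect1 hd1) hd'.
Qed.

Lemma oriented_connect x d y d' : connect (@oriented_adj w) (x, d) (y, d') ->
  connect (@circuit_adj w) x y.
Proof.
case/connectP => p; elim: p x d => [|[z e] p IH] x d /=.
  by move=> _ [-> _].
case/andP => hxz hp Ey; apply: connect_trans (IH _ _ hp Ey); apply: connect1.
by case/orP: hxz => /= /andP[/orP[] h _]; rewrite /circuit_adj h ?orbT.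
Qed.

(** Comparison with an orientation [f] stays constant along an oriented path, so the oriented
    circuit of [x] passes each of its points in one direction only: upwards exactly when [f] agrees
    there with its value at [x]. *)
Lemma mem_oriented_circuit f x y d : f \in labelings w true ->
  ((y, d) \in oriented_circuit x)
  = connect (@circuit_adj w) x y && (d == ~~ (f x (+) f y)).
Proof.
move=> hf; rewrite inE; apply/idP/andP => [h|[/(connect_oriented true)[d' h] /eqP ->]].
  split; first exact: oriented_connect h.
  by have := oriented_label hf h; case: (f x); case: (f y); case: d {h}.
by have := oriented_label hf h; case: (f x) (f y) d' h => [] [] [].
Qed.

Let crossing_part (t : nat) (x : point w) : int :=
  if onth w t is Some (Cross b, i) then
    (\sum_(d : bool * bool | ((pt w t i, d.1) \in oriented_circuit x)
        && ((pt w t i.+1, d.2) \in oriented_circuit x)) crossing_sign b d.1 d.2)%R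
  else 0%R.

(** A crossing counts for one circuit only, and only if both strands belong to it. Reversing both
    strands keeps the sign, so any orientation [f] computes it. *)
Lemma crossing_part_sum f t b i : f \in labelings w true ->
    (t < size w)%N -> nth (Cup, 0%N) w t = (Cross b, i) ->
  (\sum_(x | is_point x && (x \in roots (@circuit_adj w))) crossing_part t x
   = if connect (@circuit_adj w) (pt w t i) (pt w t i.+1)
     then crossing_sign b (f (pt w t i)) (f (pt w t i.+1)) else 0)%R.
Proof.
move=> hf ht E; rewrite /crossing_part; have [-> hi _] := letter_at rw ht.
rewrite E /= in hi *; set y1 := pt w t i; set y2 := pt w t i.+1.
have sc := sym_connect_sym circuit_adj_sym.
have p1 : is_point y1 by apply: is_point_pt => //; lia.
have sum_x x : (\sum_(d : bool * bool | ((y1, d.1) \in oriented_circuit x)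
        && ((y2, d.2) \in oriented_circuit x)) crossing_sign b d.1 d.2
   = if connect (@circuit_adj w) x y1 && connect (@circuit_adj w) x y2
     then crossing_sign b (f y1) (f y2) else 0)%R.
  under eq_bigl => d do rewrite !(mem_oriented_circuit _ _ _ hf).
  case: (connect _ x y1); case: (connect _ x y2) => /=;
    do ?by rewrite big_pred0 // => d; rewrite ?andbF.
  rewrite (big_pred1 (~~ (f x (+) f y1), ~~ (f x (+) f y2))) => [|[d1 d2]] //=.
  by rewrite /crossing_sign; case: (f x); case: (f y1); case: (f y2); case: b {E}.
under eq_bigr => x _ do rewrite sum_x.
rewrite -big_mkcondr /=; case: ifP => h12; last first.
  rewrite big_pred0 // => x; apply/negbTE; apply/negP => /andP[_ /andP[h1 h2]].
  by move: h12; rewrite (connect_trans _ h2) // sc.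
rewrite (big_pred1 (fingraph.root (@circuit_adj w) y1)) // => x; apply/andP/eqP.
  case=> /andP[_ /eqP rx] /andP[h1 _].
  by rewrite -rx; apply/(fingraph.rootP sc).
have hr : fingraph.root (@circuit_adj w) y1 \in roots (@circuit_adj w).
  exact: roots_root.
move=> ->; rewrite hr andbT; split.
  by rewrite -(connect_ind_eq circuit_adj_point (connect_root _ _)).
have h1 : connect (@circuit_adj w) (fingraph.root (@circuit_adj w) y1) y1.
  by rewrite sc connect_root.
by rewrite h1 (connect_trans h1).
Qed.

(** Reversing the circuit of one of the strands is an involution on the orientations that changes
    the sign of this crossing. *)
Lemma crossing_sign_flip t b i : (t < size w)%N -> nth (Cup, 0%N) w t = (Cross b, i) ->
    ~~ connect (@circuit_adj w) (pt w t i) (pt w t i.+1) ->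
  (\sum_(f in labelings w true)
     crossing_sign b (f (pt w t i)) (f (pt w t i.+1)) = 0)%R.
Proof.
move=> ht E h12; have [_ hi _] := letter_at rw ht; rewrite E /= in hi.
have p1 : is_point (pt w t i) by apply: is_point_pt => //; lia.
set c := connect (@circuit_adj w) (pt w t i).
have sc := sym_connect_sym circuit_adj_sym.
pose flip (f : {ffun point w -> bool}) : {ffun point w -> bool} :=
  [ffun x => f x (+) c x].
have flipK : involutive flip by move=> f'; apply/ffunP => x; rewrite !ffunE addbK.
have cE x y : @circuit_adj w x y -> c x = c y.
  by move=> hxy; rewrite /c; apply: same_connect_r => //; apply: connect1.
have flipL f' : f' \in labelings w true -> flip f' \in labelings w true.
  case/(labelings_respects rw) => h1 h2 h3 _; apply: (respects_labelings rw).
  split=> // x.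
  - rewrite ffunE; have [hx|_] := boolP (c x).
      by rewrite -(connect_ind_eq circuit_adj_point hx).
    by rewrite addbF; apply: h1.
  - move=> y hxy; rewrite !ffunE (h2 _ _ hxy) (cE x y) //.
    by rewrite /circuit_adj hxy.
  move=> y hxy; rewrite !ffunE (h3 _ _ hxy) (cE x y); first by rewrite addbAC.
  by rewrite /circuit_adj hxy !orbT.
set S := (\sum_(f in _) _)%R.
suff : S = (- S)%R by lia.
rewrite {1}/S (reindex_inj (inv_inj flipK)) /= -sumrN.
apply: eq_big => f'; first by apply/idP/idP => /flipL; rewrite ?flipK.
have c1 : c (pt w t i) by exact: connect0.
move=> _; rewrite !ffunE c1 (negbTE h12 : c _ = false).
by rewrite /crossing_sign; case: (f' _); case: (f' _); case: b {E S}.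
Qed.

(** In the sum over all orientations, crossings between different circuits cancel, and
    self-crossings contribute the same sign each time. *)
Lemma labelings_twisting :
  (#|labelings w true|%:Z * twisting_number w
   = state_sum true true id w [::] 0)%R.
Proof.
have -> : twisting_number w = (\sum_(t < size w)
    \sum_(x | is_point x && (x \in roots (@circuit_adj w))) crossing_part t x)%R.
  by rewrite exchange_big.
rewrite state_sum_histories (labelings_sum rw).
under [RHS]eq_bigr => f _ do rewrite add0r total_signE.
rewrite [RHS]exchange_big mulr_sumr; apply: eq_bigr => -[t ht] _ /=.
have [El hi _] := letter_at rw ht; have := El; rewrite /=.
case E: (nth _ w t) => [k i] Et; rewrite E /= in hi.
have [[b ek]|hk] : (exists b, k = Cross b) \/ is_cross k = false.
  by case: (k); auto; move=> b; left; exists b.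
- rewrite ek in E hi *.
  have tile_signE (f : {ffun point w -> bool}) :
    tile_sign true (Cross b, i) (nth [::] (rows f) t)
      = crossing_sign b (f (pt w t i)) (f (pt w t i.+1)).
    by rewrite /= !nth_rows //; rewrite /= in hi; lia.
  have [h12|h12] := boolP (connect (@circuit_adj w) (pt w t i) (pt w t i.+1)).
    rewrite [RHS](eq_bigr (fun _ => (\sum_(x : point w | is_point x
        && (x \in roots (@circuit_adj w))) crossing_part t x)%R)) => [|f hf].
      by rewrite sumr_const -mulr_natl natz.
    by rewrite tile_signE (crossing_part_sum hf ht E) h12.
  rewrite [RHS](_ : _ = 0)%R; last first.
    under eq_bigr => f _ do rewrite tile_signE.
    exact: crossing_sign_flip.
  have [->|[f hf]] := set_0Vmem (labelings w true); first by rewrite cards0 mul0r.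
  by rewrite (crossing_part_sum hf ht E) (negbTE h12) mulr0.
rewrite !big1 ?mulr0 // => [f _|x _].
- by case: k hk {E Et hi} => [||b|].
by rewrite /crossing_part Et; case: k hk {E Et hi} => [||b|].
Qed.

End Invariants.

(** * Comparison with the planar diagram *)

Local Open Scope ring_scope.

(** The first letter has to be a cup, so there is a point on level 1. This makes the exponent
    [c - 1] meaningful. *)
Lemma num_components_gt0 w : graph_diagram w -> (0 < num_components w)%N.
Proof.
case/andP => w0 /eqP rw; have [_ hi hw] := letter_at rw w0.
have p1 : is_point (pt w 1 0).
  apply: is_point_pt => //; rewrite hw /width take0 /= in hi *.
  by case: (nth _ _ _).1 hi; rewrite //= addnS.
have sc := sym_connect_sym (@graph_adj_sym w).
apply/card_gt0P; exists (fingraph.root (@graph_adj w) (pt w 1 0)).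
rewrite !inE roots_root //=.
have Ep := connect_ind_eq (graph_adj_point rw) (connect_root _ (pt w 1 0)).
by move: p1; rewrite Ep.
Qed.

Lemma state_sum_signless fl vx (V : nmodType) (g : int -> V) w s e :
    fl && has (fun l => is_cross l.1) w = false ->
  state_sum fl vx g w s e = state_sum fl vx (fun _ => g e) w s 0.
Proof.
elim: w s => [|[k i] w IH] s //= hk; rewrite !state_sum_consE.
rewrite [LHS]big_seq [RHS]big_seq; apply: eq_bigr => o ho.
have -> : o.2 = 0.
  case: k hk ho => [||b|] hk; case: window => [|l [|r [|x m]]] //=.
  - by rewrite !inE => /orP[] /eqP ->.
  - by case: ifP => // _; rewrite inE => /eqP ->.
  - by rewrite inE => /eqP ->; move: hk; case: (fl).
  by do ?case: ifP => _ //; rewrite inE => /eqP ->.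
rewrite !addr0 IH //; by move: hk; case: (fl) => //=; case: (is_cross k).
Qed.

Lemma state_sum_const fl (V : nmodType) (x : V) w : run 0 w = Some 0%N ->
  state_sum fl fl (fun _ => x) w [::] 0 = x *+ #|labelings w fl|.
Proof. by move=> rw; rewrite state_sum_histories (labelings_sum rw) sumr_const. Qed.

(** With the identity as weight, every state of the crossingless [w'] contributes [c]; constant
    weights show that [w] has equally many states. Their number is nonzero and can be cancelled. *)
Lemma twisting_numberE w w' (c : int) :
    run 0 w = Some 0%N -> ~~ has (fun l => is_cross l.1) w' ->
    (forall (V : nmodType) (g : int -> V) e,
      state_sum true true g w [::] e = state_sum true true g w' [::] (e + c)) ->
  twisting_number w = c.
Proof.
move=> rw hw' H; have := labelings_twisting rw; rewrite H add0r.
rewrite state_sum_signless ?(negbTE hw') // (state_sum_indep _ _ _ _ _ 0 (0 + c)) -H.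
rewrite state_sum_const // -mulr_natl natz; apply: mulfI.
by have := count_neq0 rw; rewrite state_sum_const // natz.
Qed.

Lemma varA_neq0 : varA != 0.
Proof. by rewrite tofrac_eq0 polyX_eq0. Qed.

Lemma varA_subV_neq0 : varA - varA^-1 != 0.
Proof.
apply/eqP => E; have : varA ^+ 2 - 1 = 0.
  by rewrite -(mul0r varA) -E mulrBl mulVf ?varA_neq0.
rewrite -tofracXn -tofrac1 -tofracB => /eqP; rewrite tofrac_eq0 => /eqP.
by move/(congr1 (fun p : {poly int} => p`_2)); rewrite coefB coefXn coef1 coef0.
Qed.

Lemma fraction_two_neq0 : 2%:R != 0 :> {fraction {poly int}}.
Proof.
rewrite -tofracMn tofrac_eq0; apply/eqP.
by move/(congr1 (fun p : {poly int} => p`_0)); rewrite coefMn coef1 coef0.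
Qed.

Theorem corollary5 (D : word -> laurent) (hD : dubrovnik D)
    (G : word) (hG : graph_diagram G)
    (ch : (num_vertices G).-tuple bool)
    (hplanar : exists P : word, planar_diagram P /\ ambient_isotopic G P) :
  kauffman_vogel varA varA^-1 varA D ch
  = 2 ^+ (num_components G).-1 * (- varA - varA^-1) ^+ num_vertices G
    * varA ^ twisting_number G.
Proof.
have [P [/andP[/andP[_ /eqP rP] hP] hGP]] := hplanar.
have rG : run 0 G = Some 0%N by case/andP: hG => _ /eqP.
have [_ [c H]] := ambient_state_sum hGP.
have -> : twisting_number G = c.
  by apply: (twisting_numberE rG hP) => V g e; rewrite H.
(* The factor 2 turns the values of [D] into state sums and completes [2 ^+ c.-1] to the number of
   colourings. *)
apply: (mulfI fraction_two_neq0).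
rewrite (kauffman_vogel_state_sum varA_neq0 ch hD varA_subV_neq0 fraction_two_neq0 hG).
(* Source-sink orientations of [G] are moved to [P] and become colourings there. These are counted
   back on [G], again by [H], now with zero shift. *)
rewrite H add0r (@state_sum_alternate true _ _ P [::] _ 0%N hP rP) /=.
rewrite state_sum_signless // (_ : 0 = 0 + (if false then c else 0)) // -H.
rewrite state_sum_const // card_labelings_components // -[_ *+ _]mulr_natl natrX.
rewrite -[in LHS](prednK (num_components_gt0 hG)) exprS.
by rewrite -!mulrA mulrCA; congr (_ * _); rewrite mulrCA.
Qed.
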